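(* Let $\lambda,\lambda_1,\lambda_2,\beta>0$. Let $E_N$ be a compound Poisson process with intensity $\lambda$ and exponentially distributed jumps with rate $\beta$, let $Y(t)=\inf\{u\ge 0:E_N(u)>t\}$, $t\ge 0$, be its inverse process, let $N_1,N_2$ be Poisson processes with intensities $\lambda_1,\lambda_2$, and let $N_1,N_2,Y$ be independent. Put $S_I(t)=N_1(Y(t))-N_2(Y(t))$. Then the probabilities $r_k(t)=P(S_I(t)=k)$, $k\in\mathbb{Z}$, are given by $$r_k(t)=\lambda e^{-\beta t}\left(\frac{\lambda_1}{\lambda_2}\right)^{k/2}\int_0^{\infty}e^{-u(\lambda_1+\lambda_2+\lambda)}\,I_{|k|}\bigl(2u\sqrt{\lambda_1\lambda_2}\bigr)\,I_0\bigl(2\sqrt{\lambda\beta ut}\bigr)\,du.$$ The moment generating function is given by $$\mathsf{E}e^{\theta S_I(t)}=\frac{\lambda}{\lambda+f_s(-\theta)}\exp\left(-\beta t\,\frac{f_s(-\theta)}{\lambda+f_s(-\theta)}\right)$$ for $\theta$ such that $\lambda+f_s(-\theta)\neq 0$, where $f_s(\theta)=\lambda_1(1-e^{-\theta})+\lambda_2(1-e^{\theta})$ is the Laplace exponent of the Skellam process $S(t)=N_1(t)-N_2(t)$.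
   Context: $E_N(t)=\sum_{j=1}^{N(t)}\xi_j$, where $N$ is a Poisson process with intensity $\lambda$ and $\xi_j$ are i.i.d. exponential random variables with rate $\beta$ (density $\beta e^{-\beta x}$, $x>0$), independent of $N$ (empty sum $=0$). $I_k$ is the modified Bessel function of the first kind, $I_k(z)=\sum_{n=0}^{\infty}\frac{(z/2)^{2n+k}}{n!(n+k)!}$ for integers $k\ge 0$.
   Formalization: The moment generating function formula is asserted for real θ with λ+f_s(-θ)≠0 at which E e^{θS_I(t)} is finite, and finiteness is proved when λ+f_s(-θ)>0; where λ+f_s(-θ)<0 the expectation is infinite while the displayed right-hand side is negative. *)

(* Defs.v *)
(* MathComp-Analysis *)
From HB Require Import structures.
From mathcomp Require Import all_boot all_order all_algebra.
From mathcomp Require Import all_classical all_reals all_analysis.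
Set Implicit Arguments.
Unset Strict Implicit.
Unset Printing Implicit Defensive.
Import Order.TTheory GRing.Theory Num.Theory.
Import numFieldNormedType.Exports.
Local Open Scope classical_set_scope.
Local Open Scope ring_scope.

Section Independence.
Context (d : measure_display) (T : measurableType d) (R : realType).
Variable P : probability T R.

Definition mutually_independent (I : eqType) (F : I -> set (set T)) : Prop :=
  forall (s : seq I) (A : I -> set T), uniq s ->
    (forall i, i \in s -> F i (A i)) ->
    P (\big[setI/setT]_(i <- s) A i) = (\prod_(i <- s) P (A i))%E.

Definition independent2 (F G : set (set T)) : Prop :=
  mutually_independent (tnth [tuple F; G]).

Definition independent3 (F G H : set (set T)) : Prop :=
  mutually_independent (tnth [tuple F; G; H]).

End Independence.

Definition generated_sigma_algebra (d d' : measure_display)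
    (T : measurableType d) (T' : measurableType d') (K : Type) (D : set K)
    (X : K -> T -> T') : set (set T) :=
  <<s \bigcup_(k in D) g_sigma_algebra_preimage (X k) >>.

Section Processes.
Context (d : measure_display) (T : measurableType d) (R : realType).
Variable P : probability T R.

(* Processes are indexed by R, but only the times t >= 0 are meaningful; the
   values at negative times are unconstrained and never used. *)
Definition process_sigma (d' : measure_display) (T' : measurableType d')
    (X : R -> T -> T') : set (set T) :=
  generated_sigma_algebra [set t : R | 0 <= t] X.

(* Since paths are nondecreasing, the truncated subtraction of nat is the
   genuine increment. *)
Record poisson_process (lambda : R) (N : R -> T -> nat) : Prop := {
  poisson_measurable : forall t : R, 0 <= t -> measurable_fun setT (N t) ;
  poisson_start : forall w, N 0 w = 0%N ;
  poisson_nondecreasing : forall w (s t : R), 0 <= s -> s <= t ->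
    (N s w <= N t w)%N ;
  poisson_right_continuous : forall w (t : R), 0 <= t ->
    ((N s w)%:R : R) @[s --> t^'+] --> ((N t w)%:R : R) ;
  poisson_independent_increments : forall t : nat -> R,
    0 <= t 0%N -> (forall i, t i <= t i.+1) ->
    mutually_independent P (fun i : nat =>
      g_sigma_algebra_preimage (fun w => (N (t i.+1) w - N (t i) w)%N)) ;
  poisson_increments : forall (s t : R) k, 0 <= s -> s < t ->
    P [set w | (N t w - N s w)%N = k]
    = (poisson_pmf (lambda * (t - s)) k)%:E }.

Record iid_exponential (beta : R) (xi : nat -> T -> R) : Prop := {
  exponential_measurable : forall j, measurable_fun setT (xi j) ;
  exponential_law : forall j (B : set R), measurable B ->
    P (xi j @^-1` B) = exponential_prob beta B ;
  exponential_independent :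
    mutually_independent P (fun j => g_sigma_algebra_preimage (xi j)) }.

(* The j-th jump, j >= 1, is xi (j - 1). *)
Definition compound_sum (N : R -> T -> nat) (xi : nat -> T -> R)
    (t : R) (w : T) : R :=
  \sum_(j < N t w) xi j w.

Record compound_poisson_exponential (lambda beta : R)
    (N : R -> T -> nat) (xi : nat -> T -> R) : Prop := {
  compound_poisson : poisson_process lambda N ;
  compound_jumps : iid_exponential beta xi ;
  compound_independent :
    independent2 P (process_sigma N) (generated_sigma_algebra setT xi) }.

(* The infimum of the empty set is 0 here rather than +oo; for a compound
   Poisson process with positive jumps this occurs on a null event only. *)
Definition inverse_process (E : R -> T -> R) (t : R) (w : T) : R :=
  inf [set u : R | 0 <= u /\ t < E u w].

Definition skellam (N1 N2 : R -> T -> nat) (t : R) (w : T) : int :=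
  (N1 t w)%:Z - (N2 t w)%:Z.

Definition time_changed (S : R -> T -> int) (Y : R -> T -> R)
    (t : R) (w : T) : int :=
  S (Y t w) w.

End Processes.

Definition besselI (R : realType) (k : nat) (z : R) : R :=
  limn [series (z / 2) ^+ (2 * n + k) / (n`!%:R * (n + k)`!%:R)]_n.

Definition skellam_laplace_exponent (R : realType) (l1 l2 theta : R) : R :=
  l1 * (1 - expR (- theta)) + l2 * (1 - expR theta).

(* Main.v *)
(* E_N(u) exceeds t exactly when the inverse process Y(t) is at most u, up to
   null events, and a sum of n exponential variables exceeds t with the
   probability that a Poisson variable of mean beta * t is less than n.
   Exchanging the two Poisson sums in P(E_N(u) > t) shows that Y(t) is a mixture
   of Erlang laws of rate lambda with Poisson weights of mean beta * t; its
   density is lambda * exp(- lambda * u - beta * t) *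
   I_0(2 * sqrt(lambda * beta * u * t)). Since Y(t) is independent of the
   Skellam process S, and S is locally constant on the right, the law of S(Y(t))
   is the law of S(u) integrated against this density. The formula for r_k
     follows from
   the Bessel series of P(S(u) = k), and the moment generating function from
   E(exp(theta * S(u))) = exp(- u * f_s(- theta)) by integrating the mixture
   termwise, which diverges when lambda + f_s(- theta) < 0. *)
Require Import Defs.
From HB Require Import structures.
From mathcomp Require Import all_boot all_order all_algebra.
From mathcomp Require Import all_classical all_reals all_analysis.
From mathcomp Require Import measurable_realfun.
From mathcomp Require Import zify ring lra.
Set Implicit Arguments.
Unset Strict Implicit.
Unset Printing Implicit Defensive.
Import Order.TTheory GRing.Theory Num.Theory.
Import numFieldNormedType.Exports.
Local Open Scope classical_set_scope.
Local Open Scope ring_scope.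

(** * Evaluation of a process at an independent random time *)

(** Substituting an independent random time into a family of events is done without conditional
    laws. In [probability_randomization] the random time is rounded to a grid, independence is used
    on each cell at a fixed time, and dominated convergence removes the rounding; this asks for the
    events to be constant on one side of each time. The lemma serves twice, with opposite roundings:
    upwards for the time change, because Poisson paths are right continuous, and downwards for
    adding one exponential variable to a sum, because the closed condition that a sum is at most
    [t - u] survives a decrease of [u]. The null events behind the equivalence of Y(t) <= u and
    E_N(u) > t are those where some jump is nonpositive or the level t is never exceeded; the latter
    is shown to be null only afterwards, from the total mass 1 of the density. Exchanges of sums and
    integrals concern nonnegative extended reals, so the moment generating function equals an
    integral against the density even when both are infinite, and its finiteness is decided last. *)

Lemma cvg_probability (d : measure_display) (T : measurableType d)
    (R : realType) (P : probability T R) (B_ : nat -> set T) (B : set T) :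
    (forall n, measurable (B_ n)) ->
    (forall w, \forall n \near \oo, B_ n w <-> B w) ->
  measurable B /\ P (B_ n) @[n --> \oo] --> P B.
Proof.
move=> mB_ B_B.
have mB : measurable B.
  (* [B] is the lower limit of the sets [B_ n]. *)
  rewrite (_ : B = \bigcup_n \bigcap_(k in [set k | (n <= k)%N]) B_ k).
    apply: bigcupT_measurable => n.
    by apply: bigcap_measurable => [|k _]; [exists n => /= |].
  apply/seteqP; split=> [w Bw|w [n _ Bnw]].
    have [n _ nB] := B_B w.
    by exists n => // k /= /nB [_]; exact.
  have [m _ mBw] := B_B w.
  have /mBw [+ _] : (m <= maxn m n)%N by rewrite leq_maxl.
  by apply; apply: Bnw => /=; rewrite leq_maxr.
split => //.
have intP C : measurable C -> P C = (\int[P]_x (\1_C x)%:E)%E.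
  by move=> mC; rewrite integral_indic// setIT.
rewrite intP//; under eq_fun do rewrite intP//.
have [] // := @dominated_convergence _ _ _ P setT measurableT
  (fun n x => (\1_(B_ n) x)%:E) (fun x => (\1_B x)%:E) (cst 1%E).
- by move=> n; apply/measurable_EFinP; exact: measurable_indic.
- by apply/measurable_EFinP; exact: measurable_indic.
- apply: aeW => w _; apply: cvg_near_cst.
  near=> n; rewrite !indicE.
  have H : B_ n w <-> B w by near: n; exact: B_B.
  suff -> : (w \in B_ n) = (w \in B) by [].
  by apply/idP/idP; rewrite !inE => /H.
- exact: finite_measure_integrable_cst.
- by apply: aeW => w n _ /=; rewrite indicE lee_fin; case: (_ \in _);
    rewrite (normr1,normr0).
Unshelve. all: by end_near. Qed.

(* The half-line y > 0 is cut into the cells j / (n + 1) < y <= (j + 1) /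
   (n + 1), whose left and right endpoints are the [grid_point]s for [c = false]
   and [c = true]. *)
Definition grid_cell (R : realType) (n : nat) (y : R) : nat :=
  (`|Num.ceil (n.+1%:R * y)|.-1)%N.

Definition grid_point (R : realType) (c : bool) (n j : nat) : R :=
  (j + c)%:R / n.+1%:R.

Definition grid_itv (R : realType) (n j : nat) : set R :=
  `](grid_point R false n j), (grid_point R true n j)].

Section Grid.
Variable R : realType.
Implicit Types (y : R) (n j : nat) (c : bool).

Lemma grid_point_ge0 c n j : 0 <= grid_point R c n j.
Proof. by rewrite divr_ge0. Qed.

Lemma grid_point_lt n j : grid_point R false n j < grid_point R true n j.
Proof. by rewrite ltr_pM2r ?invr_gt0// ltr_nat addn0 addn1. Qed.

Lemma grid_itvP n j y : grid_itv n j y <-> 0 < y /\ grid_cell n y = j.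
Proof.
have n0 : 0 < n.+1%:R :> R by [].
have -> : grid_itv n j y <-> j%:R < n.+1%:R * y <= j.+1%:R.
  rewrite /grid_itv /grid_point /= in_itv/= addn0 addn1.
  by rewrite ltr_pdivrMr// ler_pdivlMr// mulrC.
split=> [jy|[y0 <-]].
  have y0 : 0 < y.
    by case/andP: jy => /(le_lt_trans (ler0n _ _)); rewrite pmulr_rgt0.
  split => //; rewrite /grid_cell.
  suff -> : Num.ceil (n.+1%:R * y) = j.+1%:Z by [].
  by apply: ceil_def; rewrite -[in X in X < _]addn1 PoszD addrK.
rewrite /grid_cell.
have : 0 < Num.ceil (n.+1%:R * y) by rewrite ceil_gt0 mulr_gt0.
have := ceil_itv (n.+1%:R * y).
case: (Num.ceil _) => // -[//|m] /= + _.
by rewrite -[in X in X < _]addn1 PoszD addrK.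
Qed.

Lemma bigcup_grid_itv n : \bigcup_j grid_itv n j = `]0%R, +oo[%classic :> set R.
Proof.
apply/seteqP; split=> [y [j _ /grid_itvP[y0 _]]|y /=].
  by rewrite /= in_itv/= y0.
by rewrite in_itv/= andbT => y0; exists (grid_cell n y) => //; apply/grid_itvP.
Qed.

Lemma trivIset_grid_itv n : trivIset setT (@grid_itv R n).
Proof. by move=> i j _ _ [y [/grid_itvP[_ <-] /grid_itvP[_ <-]]]. Qed.

Lemma measurable_grid_itv n j : measurable (@grid_itv R n j).
Proof. exact: measurable_itv. Qed.

(** Cells are open on the left and closed on the right: the left endpoint stays strictly below [y],
    while the right one may equal it. The two cases match left- and right-sided constancy. *)
Lemma near_grid_point c y (e : R) : 0 < y -> 0 < e ->
  \forall n \near \oo, if c then y <= grid_point R c n (grid_cell n y) < y + e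
    else y - e < grid_point R c n (grid_cell n y) < y.
Proof.
move=> y0 e0; near=> n.
have : grid_itv n (grid_cell n y) y by apply/grid_itvP.
rewrite /grid_itv /= in_itv/= => /andP[y1 y2].
have dz : grid_point R true n (grid_cell n y) =
    grid_point R false n (grid_cell n y) + n.+1%:R^-1.
  by rewrite /grid_point natrD addn0 mulrDl mul1r.
have ne : n.+1%:R^-1 < e by near: n; exact: near_infty_natSinv_lt (PosNum e0).
move: y1 y2 dz ne; move: n.+1%:R^-1 => x.
case: c; move: (grid_point _ true _ _) => b;
  by move: (grid_point _ false _ _) => a y1 y2 dz ne; apply/andP; split; lra.
Unshelve. all: by end_near. Qed.

End Grid.

Section Randomization.
Context (d : measure_display) (T : measurableType d) (R : realType).
Variables (P : probability T R) (Y : T -> R) (f : R -> R) (Z : R -> set T).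
Variable c : bool.
Hypothesis mY : measurable_fun setT Y.
Hypothesis mf : measurable_fun (`]0, +oo[ : set R) f.
Hypothesis f_ge0 : forall u : R, 0 < u -> 0 <= f u.
(** [f] describes the law of [Y] on the positive half-line only; the mass elsewhere is left to the
    applications, whence the condition [0 < Y w] in the conclusion. *)
Hypothesis YE : forall a b : R, 0 <= a -> a < b ->
  P (Y @^-1` `]a, b]) = (\int[lebesgue_measure]_(u in `]a, b]) (f u)%:E)%E.
Hypothesis mZ : forall u : R, 0 <= u -> measurable (Z u).
Hypothesis ZY : forall u a b : R, 0 <= u -> 0 <= a -> a < b ->
  (P (Z u `&` Y @^-1` `]a, b]) = P (Z u) * P (Y @^-1` `]a, b]))%E.
Hypothesis Z_cst : forall w (y : R), 0 < y -> exists2 e : R, 0 < e &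
  forall v : R, 0 <= v -> (if c then y <= v < y + e else y - e < v < y) ->
  Z v w <-> Z y w.

Let q n (y : R) := grid_point R c n (grid_cell n y).

Let near_Zq w (y : R) : 0 < y -> \forall n \near \oo, Z (q n y) w <-> Z y w.
Proof.
move=> y0; have [e e0 Ze] := Z_cst w y0; near=> n.
apply: Ze; first exact: grid_point_ge0.
by near: n; exact: near_grid_point.
Unshelve. all: by end_near. Qed.

Let cvg_PZ (u : R) : 0 < u -> P (Z (q n u)) @[n --> \oo] --> P (Z u).
Proof.
move=> u0; have [] // := @cvg_probability _ _ _ P (fun n => Z (q n u)) (Z u).
  by move=> n; exact/mZ/grid_point_ge0.
by move=> w; exact: near_Zq.
Qed.

Let measurable_PZq n : measurable_fun (`]0, +oo[ : set R) (fun u =>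
  P (Z (q n u))).
Proof.
rewrite -(bigcup_grid_itv R n); apply/measurable_fun_bigcup => j.
  exact: measurable_grid_itv.
apply: (eq_measurable_fun (cst (P (Z (grid_point R c n j))))).
  by move=> u /set_mem/grid_itvP[_ <-].
exact: measurable_cst.
Qed.

(** Rounded to the grid, the probability is a step function of [u]; a pointwise limit of these is
    measurable, without joint measurability of [Z] in time and outcome. *)
Lemma measurable_randomized_probability :
  measurable_fun (`]0, +oo[ : set R) (fun u => P (Z u)).
Proof.
apply: (emeasurable_fun_cvg (fun n u => P (Z (q n u)))) => //= u.
by rewrite in_itv/= andbT => /cvg_PZ.
Qed.

Let mfE : measurable_fun (`]0, +oo[ : set R) (EFin \o f).
Proof. exact/measurable_EFinP. Qed.

Let integral_grid n (g : R -> \bar R) :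
    measurable_fun (`]0, +oo[ : set R) g -> (forall u : R, (0 < u)%R -> 0 <= g
      u)%E ->
  (\int[lebesgue_measure]_(u in `]0%R, +oo[) g u =
   \sum_(j <oo) \int[lebesgue_measure]_(u in grid_itv n j) g u)%E.
Proof.
move=> mg g0; rewrite -(bigcup_grid_itv R n) ge0_integral_bigcup//.
- exact: measurable_grid_itv.
- by rewrite bigcup_grid_itv.
- by move=> u; rewrite bigcup_grid_itv /= in_itv/= andbT => /g0.
- exact: trivIset_grid_itv.
Qed.

(** The integrals of [f] over the unit cells are probabilities of disjoint events, so they add up to
    at most 1. *)
Let integrable_f :
  (@lebesgue_measure R).-integrable (`]0, +oo[ : set R) (EFin \o f).
Proof.
apply/integrableP; split => //.
under eq_integral => u.
  rewrite inE/= in_itv/= andbT => u0.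
  rewrite ger0_norm ?f_ge0//.

over.
rewrite (@integral_grid 0%N)//.
under eq_eseriesr => j _ do
  rewrite -YE ?grid_point_ge0 ?grid_point_lt//.
have mYI j : measurable (Y @^-1` grid_itv 0 j).
  by rewrite -[X in measurable X]setTI; apply: mY => //;
    exact: measurable_grid_itv.
rewrite -measure_semi_bigcup//=; last 2 first.
- move=> i j _ _ [w [/= ]].
  move=> /(@grid_itvP R 0 i)[_ <-].
  by move=> /(@grid_itvP R 0 j)[_ <-].
- exact: bigcupT_measurable.
by apply: le_lt_trans (probability_le1 _ _) _; rewrite ?ltry//;
  exact: bigcupT_measurable.
Qed.

Let A n := [set w | 0 < Y w /\ Z (q n (Y w)) w].

Let AE n : A n = \bigcup_j (Z (grid_point R c n j) `&` Y @^-1` grid_itv n j).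
Proof.
apply/seteqP; split=> [w [Yw0 Zw]|w [j _ [Zw /grid_itvP[Yw0 Yj]]]].
  exists (grid_cell n (Y w)) => //; split => //.
  exact/grid_itvP.
by split => //; rewrite /q Yj.
Qed.

Let mZY n j : measurable (Z (grid_point R c n j) `&` Y @^-1` grid_itv n j).
Proof.
apply: measurableI; first exact/mZ/grid_point_ge0.
by rewrite -[X in measurable X]setTI; apply: mY => //;
  exact: measurable_grid_itv.
Qed.

Let PA n : P (A n) =
  (\int[lebesgue_measure]_(u in `]0%R, +oo[) (P (Z (q n u)) * (f u)%:E))%E.
Proof.
rewrite AE measure_semi_bigcup//; last 2 first.
- by move=> i j _ _ [w [[_ /grid_itvP[_ <-]] [_ /grid_itvP[_ <-]]]].
- exact: bigcupT_measurable.
rewrite (integral_grid n); last 2 first.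
- exact: emeasurable_funM.
- by move=> u u0; rewrite mule_ge0 ?lee_fin ?f_ge0.
apply: eq_eseriesr => j _.
have c0 := grid_point_ge0 R c n j; have f0 := grid_point_ge0 R false n j.
have lt := grid_point_lt R n j.
apply: etrans (ZY c0 f0 lt) _; rewrite (YE f0 lt) -ge0_integralZl//.
- by apply: eq_integral => u /set_mem/grid_itvP[_ <-].
- apply: measurable_funS mfE => //.
  by rewrite -(bigcup_grid_itv R n) => u nju; exists j.
- by move=> u /grid_itvP[u0 _]; rewrite lee_fin f_ge0.
Qed.

(* Both sides are limits of their discretizations along the grid of mesh
   [1 / (n + 1)], for which independence applies cell by cell. *)
Lemma probability_randomization :
  measurable [set w | 0 < Y w /\ Z (Y w) w] /\
  P [set w | 0 < Y w /\ Z (Y w) w] =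
  (\int[lebesgue_measure]_(u in `]0%R, +oo[) (P (Z u) * (f u)%:E))%E.
Proof.
have [||mA cvgA] := @cvg_probability _ _ _ P A [set w | 0 < Y w /\ Z (Y w) w].
- by move=> n; rewrite AE; exact: bigcupT_measurable.
- move=> w; have [Yw0|Yw0] := ltP 0 (Y w); last first.
    by apply: nearW => n; split=> -[]; rewrite ltNge Yw0.
  near=> n.
  have Zqw : Z (q n (Y w)) w <-> Z (Y w) w by near: n; exact: near_Zq.
  by split=> -[_ /Zqw].
split => //; apply: (cvg_unique _ cvgA) => //.
rewrite (_ : (fun n => P (A n)) = (fun n =>
  \int[lebesgue_measure]_(u in `]0%R, +oo[) (P (Z (q n u)) * (f u)%:E))%E);
  last by apply/funext => n; rewrite PA.
have [] // := @dominated_convergence _ _ _ (@lebesgue_measure R)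
  (`]0, +oo[ : set R) (measurable_itv _)
  (fun n u => P (Z (q n u)) * (f u)%:E)%E (fun u => P (Z u) * (f u)%:E)%E
  (EFin \o f).
- by move=> n; apply: emeasurable_funM; [exact: measurable_PZq|exact: mfE].
- by apply: emeasurable_funM;
    [exact: measurable_randomized_probability|exact: mfE].
- apply: aeW => u; rewrite /= in_itv/= andbT => u0.
  by apply: cvgeZr => //; exact: cvg_PZ.
- apply: aeW => u n; rewrite /= in_itv/= andbT => u0.
  rewrite gee0_abs ?mule_ge0 ?lee_fin ?f_ge0// -[leRHS]mul1e.
  apply: lee_wpmul2r; first by rewrite lee_fin f_ge0.
  exact/probability_le1/mZ/grid_point_ge0.
Unshelve. all: by end_near. Qed.

End Randomization.

(** * Poisson weights and Bessel series *)

Section Calculus.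
Variable R : realType.
Implicit Types (F f : R -> R) (a b x : R).

Lemma continuous_is_derive F f : (forall x, is_derive x 1 F (f x)) ->
  continuous F.
Proof.
move=> dF x; apply: differentiable_continuous.
by apply/derivable1_diffP; case: (dF x).
Qed.

Lemma integral_is_derive F f a b : a <= b ->
    (forall x, is_derive x 1 F (f x)) -> continuous f ->
  (\int[lebesgue_measure]_(x in `[a, b]) (f x)%:E)%E = (F b - F a)%:E.
Proof.
rewrite le_eqVlt => /predU1P[<- _ _|ab dF cf].
  by rewrite set_itv1 integral_set1 subrr.
have cF := continuous_is_derive dF.
rewrite (@continuous_FTC2 _ f F)//.
- by apply: continuous_subspaceT.
- split; first by move=> x _; case: (dF x).
  + exact/cvg_at_right_filter/cF.
  + exact/cvg_at_left_filter/cF.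
- by move=> x _; rewrite derive1E; case: (dF x).
Qed.

Lemma integral_is_derive_pinfty F f a (l : R) : (forall x, a <= x -> 0 <= f x)
  ->
    (forall x, is_derive x 1 F (f x)) -> continuous f ->
    F x @[x --> +oo%R] --> l ->
  (\int[lebesgue_measure]_(x in `[a, +oo[) (f x)%:E)%E = (l - F a)%:E.
Proof.
move=> f0 dF cf Fl; have cF := continuous_is_derive dF.
rewrite (@ge0_continuous_FTC2y _ f F _ l)//.
- by apply: continuous_subspaceT.
- exact/cvg_at_right_filter/cF.
- by move=> x _; rewrite derive1E; case: (dF x).
Qed.

Lemma is_derive_mulrl (c x : R) : is_derive x 1 (fun y => c * y) c.
Proof.
have := @is_deriveM _ _ (cst c) id x 1 0 1 (is_derive_cst _ _ _) (is_derive_id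
  _ _).
by move=> H; apply: is_derive_eq; rewrite scaler0 addr0 /GRing.scale /= mulr1.
Qed.

Lemma is_derive_exp_mull (c x : R) :
  is_derive x 1 (fun y => expR (c * y)) (c * expR (c * x)).
Proof.
have := @is_derive1_comp _ expR (fun y => c * y) x _ _ (is_derive_expR _)
   (is_derive_mulrl c x).
by move=> H; apply: is_derive_eq; rewrite mulrC.
Qed.

End Calculus.

(** Unlike [poisson_pmf], the same formula for every [m], so that it can be differentiated
    everywhere and covers the mean 0. *)
Definition pois (R : realType) (m : R) (k : nat) : R :=
  m ^+ k / k`!%:R * expR (- m).

(* The probability that a Poisson variable of mean [m] is at least [n]. *)
Definition pois_tail (R : realType) (m : R) (n : nat) : R :=
  1 - \sum_(j < n) pois m j.

Section Poisson.
Variable R : realType.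
Implicit Types (m c u v x : R) (n k j : nat).

Lemma pois_ge0 m k : 0 <= m -> 0 <= pois m k.
Proof. by move=> m0; rewrite mulr_ge0 ?expR_ge0// divr_ge0// exprn_ge0. Qed.

Lemma poisson_pmfE m k : 0 < m -> poisson_pmf m k = pois m k.
Proof. by move=> m0; rewrite /poisson_pmf m0. Qed.

Lemma pois0 k : pois (0 : R) k = (k == 0)%:R.
Proof.
rewrite /pois oppr0 expR0 mulr1 expr0n; case: k => [|k] /=.
  by rewrite divr1.
by rewrite mul0r.
Qed.

Lemma natr_fact_neq0 n : (n`!%:R : R) != 0.
Proof. by rewrite pnatr_eq0 -lt0n fact_gt0. Qed.

Lemma natr_factS n : (n.+1`!%:R : R) = n.+1%:R * n`!%:R.
Proof. by rewrite factS natrM. Qed.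

Lemma is_derive_pois c x k : is_derive x 1 (fun y => pois (c * y) k)
  (c * ((if k is k'.+1 then pois (c * x) k' else 0) - pois (c * x) k)).
Proof.
have dX := @is_deriveX _ _ (fun y => c * y) k x 1 c (is_derive_mulrl c x).
have dE := is_derive_exp_mull (- c) x.
have dC := is_derive_cst ((k`!%:R : R)^-1) x 1.
have dM := is_deriveM (is_deriveM dX dC) dE.
rewrite (_ : (fun y => pois (c * y) k) =
  ((fun y => c * y) ^+ k * cst (k`!%:R)^-1) * (fun y => expR (- c * y)));
    last first.
  apply/funext => y; rewrite /pois -mulNr.
  by rewrite /GRing.mul /= /GRing.mul /= exprfctE.
apply: is_derive_eq; rewrite /pois -mulNr /GRing.scale /= /cst.
rewrite [(_ * _) x]/GRing.mul /= exprfctE mulr0 add0r.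
case: k {dX dC dM} => [|k].
  by rewrite expr0 fact0 divr1; ring.
rewrite -mulr_natl natr_factS /=.
by field; rewrite natr_fact_neq0 nat1r pnatr_eq0.
Qed.

(** The derivatives of the weights telescope and leave the Erlang density of shape [n + 1] and rate
    [c]. *)
Lemma is_derive_pois_tail c x n :
  is_derive x 1 (fun y => pois_tail (c * y) n.+1) (c * pois (c * x) n).
Proof.
elim: n => [|n IHn].
  have H := is_derive_pois c x 0.
  have := is_deriveB (is_derive_cst (1 : R) x 1) H.
  rewrite (_ : _ - _ = (fun y => pois_tail (c * y) 1)); last first.
    by apply/funext => y; rewrite /pois_tail big_ord1.
  by move=> {}H; apply: is_derive_eq; ring.
have := is_deriveB IHn (is_derive_pois c x n.+1).
rewrite (_ : _ - _ = (fun y => pois_tail (c * y) n.+2)); last first.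
  apply/funext => y; rewrite /pois_tail [in RHS]big_ord_recr /=.
  by rewrite opprD addrA.
by move=> H; apply: is_derive_eq; ring.
Qed.

Lemma continuous_pois c n : continuous (fun x => pois (c * x) n).
Proof. by apply: continuous_is_derive => x; exact: is_derive_pois. Qed.

Lemma measurable_pois (D : set R) c n : measurable_fun D (fun x =>
  pois (c * x) n).
Proof.
apply: measurable_funTS; apply: continuous_measurable_fun.
exact: continuous_pois.
Qed.

Lemma continuousZ_pois c n : continuous (fun x => c * pois (c * x) n).
Proof. by move=> x; apply: cvgM; [exact: cvg_cst|exact: continuous_pois]. Qed.

Lemma pois_tail0 n : pois_tail (0 : R) n.+1 = 0.
Proof.
rewrite /pois_tail big_ord_recl /= pois0 big1 ?addr0 ?subrr// => i _.
by rewrite pois0.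
Qed.

Lemma integral_pois c u n : 0 <= u ->
  (\int[lebesgue_measure]_(v in `[0%R, u]) (c * pois (c * v) n)%:E)%E =
  (pois_tail (c * u) n.+1)%:E.
Proof.
move=> u0; rewrite (integral_is_derive u0 (fun x => is_derive_pois_tail c x n)).
  by rewrite mulr0 pois_tail0 subr0.
exact: continuousZ_pois.
Qed.

Lemma cvg_pois_pinfty c n : 0 < c -> pois (c * x) n @[x --> +oo%R] --> (0 : R).
Proof.
move=> c0.
(* Bounding the exponential below by the term of degree [n + 1] of its series gives decay of order 1
   / x. *)
have le_pois x : 0 < x -> pois (c * x) n <= n.+1%:R / c * x^-1.
  move=> x0; have cx0 := mulr_gt0 c0 x0.
  have := expR_ge1Dxn n (ltW cx0); rewrite natr_factS => /(le_trans _) H.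
  have {}H : (c * x) ^+ n.+1 / (n.+1%:R * n`!%:R) <= expR (c * x).
    by apply: H; rewrite lerDr.
  rewrite /pois expRN -ler_pdivlMr ?invr_gt0 ?expR_gt0// invrK.
  rewrite (_ : _ / n`!%:R = (n.+1%:R / c * x^-1) *
     ((c * x) ^+ n.+1 / (n.+1%:R * n`!%:R))).
    by rewrite ler_pM2l// mulr_gt0 ?invr_gt0// divr_gt0.
  rewrite exprS; field.
  by rewrite natr_fact_neq0 nat1r pnatr_eq0 !gt_eqF.
apply: (squeeze_cvgr (f := fun=> 0) (h := fun x => n.+1%:R / c * x^-1)).
- near=> x; have x0 : 0 < x by near: x; exact: nbhs_pinfty_gt.
  by rewrite le_pois// pois_ge0// mulr_ge0 ?ltW.
- exact: cvg_cst.
- rewrite -[X in _ --> X](mulr0 (n.+1%:R / c)).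
  apply: cvgM; first exact: cvg_cst.
  by apply/gtr0_cvgV0; [exact: nbhs_pinfty_gt|exact: cvg_id].
Unshelve. all: by end_near. Qed.

Lemma pois_tailS m n : pois_tail m n.+1 = pois_tail m n - pois m n.
Proof. by rewrite /pois_tail big_ord_recr opprD addrA. Qed.

Lemma cvg_pois_tail_pinfty c n : 0 < c ->
  pois_tail (c * x) n @[x --> +oo%R] --> (1 : R).
Proof.
move=> c0; elim: n => [|n IHn].
  rewrite /pois_tail; under eq_fun do rewrite big_ord0 subr0.
  exact: cvg_cst.
under eq_fun do rewrite pois_tailS.
rewrite (_ : 1 = 1 - 0); last by rewrite subr0.
by apply: cvgB => //; exact: cvg_pois_pinfty.
Qed.

Lemma integral_pois_pinfty c n : 0 < c ->
  (\int[lebesgue_measure]_(v in `[0%R, +oo[) (c * pois (c * v) n)%:E)%E = 1%E.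
Proof.
move=> c0.
rewrite (integral_is_derive_pinfty _ (fun x => is_derive_pois_tail c x n) _
  (cvg_pois_tail_pinfty n.+1 c0)).
- by rewrite mulr0 pois_tail0 subr0.
- by move=> x x0; rewrite mulr_ge0 ?(ltW c0)// pois_ge0// mulr_ge0// ltW.
- exact: continuousZ_pois.
Qed.

End Poisson.

Section PoissonSeries.
Variable R : realType.
Implicit Types (m c b t u v x z : R) (n k j : nat).

Lemma nneseries_EFin (u : nat -> R) : cvgn (series u) ->
  (\sum_(n <oo) (u n)%:E)%E = (limn (series u))%:E.
Proof.
move=> cu; rewrite -EFin_lim//; apply/congr_lim/funext => n /=.
by rewrite sumEFin.
Qed.

Lemma nneseries_exp x : 0 <= x ->
  (\sum_(n <oo) (x ^+ n / n`!%:R)%:E)%E = (expR x)%:E.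
Proof. by move=> x0; rewrite nneseries_EFin//;
  exact: is_cvg_series_exp_coeff. Qed.

Lemma nneseries_exp_tilt m a : 0 <= m ->
  (\sum_(n <oo) (expR (a * n%:R) * pois m n)%:E)%E =
  (expR (m * (expR a - 1)))%:E.
Proof.
move=> m0; have e0 : (0 <= (expR (- m))%:E)%E by rewrite lee_fin expR_ge0.
under eq_eseriesr => n _.
  rewrite (_ : _ * _ = expR (- m) * ((expR a * m) ^+ n / n`!%:R)); last first.
    rewrite /pois exprMn expRM_natr; ring.
  rewrite EFinM; over.
have am0 : 0 <= expR a * m by rewrite mulr_ge0 ?expR_ge0.
rewrite nneseriesZl/= => [|n _]; last by rewrite lee_fin divr_ge0 ?exprn_ge0.
by rewrite nneseries_exp// -EFinM -expRD; congr (expR _)%:E; ring.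
Qed.

Lemma nneseries_pois m : 0 <= m -> (\sum_(n <oo) (pois m n)%:E)%E = 1%E.
Proof.
move=> m0; have := nneseries_exp_tilt 0 m0; rewrite expR0 subrr mulr0 expR0 =>
  <-.
by apply: eq_eseriesr => n _; rewrite mul0r expR0 mul1r.
Qed.

Lemma nneseries_pois_tail m j : 0 <= m ->
  (\sum_(n <oo) ((j < n)%N%:R * pois m n)%:E)%E = (pois_tail m j.+1)%:E.
Proof.
move=> m0; have p0 n : (0 <= (pois m n)%:E)%E by rewrite lee_fin pois_ge0.
have jp0 n : (0 <= ((j < n)%N%:R * pois m n)%:E)%E.
  by rewrite lee_fin mulr_ge0// pois_ge0.
have split0 (g : nat -> R) : (forall n, (0 <= (g n)%:E)%E) ->
    (\sum_(n <oo) (g n)%:E)%E =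
    (\sum_(0 <= n < j.+1) (g n)%:E + \sum_(j.+1 <= n <oo) (g n)%:E)%E.
  by move=> g0; rewrite (nneseries_split 0 j.+1).
have tailE : (\sum_(j.+1 <= n <oo) ((j < n)%N%:R * pois m n)%:E)%E =
    (\sum_(j.+1 <= n <oo) (pois m n)%:E)%E.
  apply: congr_lim; apply/funext => N; apply: eq_big_nat => n /andP[jn _].
  by rewrite jn mul1r.
rewrite (split0 _ jp0) big_nat big1 ?add0e => [|n /= nj]; last first.
  by rewrite ltnNge -ltnS nj mul0r.
rewrite tailE; have := nneseries_pois m0;
  rewrite (split0 _ p0) big_mkord sumEFin.
have : (0 <= \sum_(j.+1 <= n <oo) (pois m n)%:E)%E by exact: nneseries_ge0.
(* The total mass 1 excludes an infinite remainder and nonnegativity excludes minus infinity, so the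
   subtraction is legitimate. *)
by case: (limn _) => // r _ [H]; rewrite /pois_tail -H addrAC subrr add0r.
Qed.

Lemma continuous_pois_tail c n : continuous (fun x => pois_tail (c * x) n).
Proof.
case: n => [|n].
  by rewrite /pois_tail; under eq_fun do rewrite big_ord0;
    exact: cst_continuous.
by apply: continuous_is_derive => x; exact: is_derive_pois_tail.
Qed.

(* A primitive is [- expR (- b * x) * pois_tail (b * (t - x)) n.+1]. *)
Lemma integral_pois_tail_exponential b t n : 0 <= t ->
  (\int[lebesgue_measure]_(x in `[0%R, t])
    (pois_tail (b * (t - x)) n * (b * expR (- b * x)))%:E)%E =
  (pois_tail (b * t) n.+1)%:E.
Proof.
move=> t0; pose F x := - expR (- b * x) * pois_tail (b * (t - x)) n.+1.
have dB x : is_derive x 1 (fun y => t - y) (- 1).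
  have := is_deriveB (is_derive_cst t x 1) (is_derive_id x (1 : R)).
  by move=> H; apply: is_derive_eq; rewrite sub0r.
have dF x : is_derive x 1 F (pois_tail (b * (t - x)) n * (b * expR (- b * x))).
  have dT := @is_derive1_comp _ (fun y => pois_tail (b * y) n.+1)
    (fun y => t - y) x _ _ (is_derive_pois_tail b (t - x) n) (dB x).
  have dM := is_deriveM (is_deriveN (is_derive_exp_mull (- b) x)) dT.
  apply: is_derive_eq; rewrite /GRing.scale /= opprfctE pois_tailS; ring.
rewrite (integral_is_derive t0 dF).
  rewrite /F subrr !mulr0 pois_tail0 mulr0 expR0 sub0r mulN1r opprK.
  by rewrite subr0.
move=> x; apply: cvgM.
  apply: (@continuous_comp _ _ _ (fun x => t - x) (fun x =>
    pois_tail (b * x) n)).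
    by case: (dB x) => /derivable1_diffP /differentiable_continuous.
  exact: continuous_pois_tail.
apply: cvgM; first exact: cvg_cst.
exact: (continuous_is_derive (is_derive_exp_mull (- b))).
Qed.

End PoissonSeries.

Lemma measurable_exp_mull (R : realType) (D : set R) (c : R) :
  measurable_fun D (fun x => expR (c * x)).
Proof.
apply: measurable_funTS; apply: continuous_measurable_fun.
by apply: continuous_is_derive => x; exact: is_derive_exp_mull.
Qed.

(** * The density of the inverse process *)

Section Bessel.
Variable R : realType.
Implicit Types (a b c l t u v z : R) (j k n : nat).

Lemma nneseries_besselI k z : 0 <= z ->
  (\sum_(n <oo) ((z / 2) ^+ (2 * n + k) / (n`!%:R * (n + k)`!%:R))%:E)%E =
  (besselI k z)%:E.
Proof.
move=> z0; have y0 : 0 <= z / 2 by rewrite divr_ge0.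
rewrite nneseries_EFin//.
(* Dropping the factor [(n + k)!] from the denominator leaves [(z / 2) ^+ k] times the exponential
   series at [(z / 2) ^+ 2]. *)
apply: (@series_le_cvg _ _ (fun n => (z / 2) ^+ k *
    exp_coeff ((z / 2) ^+ 2) n)).
- by move=> n; rewrite divr_ge0 ?mulr_ge0// exprn_ge0.
- by move=> n; rewrite mulr_ge0 ?exp_coeff_ge0 ?exprn_ge0.
- move=> n; rewrite /exp_coeff /= exprD exprM [_ ^+ n * _]mulrC [leRHS]mulrA.
  rewrite ler_wpM2l ?mulr_ge0 ?exprn_ge0//.
  rewrite lef_pV2 ?posrE ?mulr_gt0 ?ltr0n ?fact_gt0//.
  by rewrite ler_peMr// ler1n fact_gt0.
- exact: is_cvg_seriesZ (is_cvg_series_exp_coeff _).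
Qed.

(* The density at [u > 0] of the inverse process at time [t]: a mixture, with
   Poisson weights of mean [b * t], of the Erlang laws of shape [j + 1] and rate
   [l]. *)
Definition inverse_density l b t u : R :=
  l * expR (- (b * t)) *
  (expR (- (u * l)) * besselI 0 (2 * Num.sqrt (l * b * u * t))).

(** Of the two factors [n!] in the denominators of I_0, one belongs to the Poisson weight and the
    other to the Erlang density. *)
Lemma inverse_densityE l b t u : 0 <= l -> 0 <= b -> 0 <= t -> 0 <= u ->
  (inverse_density l b t u)%:E =
  (\sum_(j <oo) (pois (b * t) j * (l * pois (l * u) j))%:E)%E.
Proof.
move=> l0 b0 t0 u0.
have q0 : 0 <= l * b * u * t by rewrite !mulr_ge0.
rewrite /inverse_density mulrA EFinM -nneseries_besselI ?mulr_ge0 ?sqrtr_ge0//.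
rewrite -nneseriesZl/= => [|n _]; last first.
  by rewrite lee_fin divr_ge0 ?mulr_ge0// exprn_ge0// divr_ge0 ?mulr_ge0
    ?sqrtr_ge0.
apply: eq_eseriesr => n _; rewrite -EFinM; congr EFin.
rewrite !addn0 (_ : 2 * _ / 2 = Num.sqrt (l * b * u * t)); last by field.
rewrite exprM sqr_sqrtr// /pois !exprMn.
rewrite (mulrC u l).
by field; rewrite natr_fact_neq0.
Qed.

Lemma inverse_density_ge0 l b t u : 0 <= l -> 0 <= b -> 0 <= t -> 0 <= u ->
  0 <= inverse_density l b t u.
Proof.
move=> l0 b0 t0 u0; rewrite -lee_fin inverse_densityE//; apply: nneseries_ge0.
by move=> n _ _; rewrite lee_fin !(pois_ge0,mulr_ge0).
Qed.

Lemma measurable_inverse_density l b t (D : set R) : 0 <= l -> 0 <= b ->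
    0 <= t -> measurable D -> D `<=` `[0, +oo[ ->
  measurable_fun D (inverse_density l b t).
Proof.
move=> l0 b0 t0 mD D0; apply/measurable_EFinP.
have {}D0 u : D u -> 0 <= u by move=> /D0; rewrite /= in_itv/= andbT.
apply: (eq_measurable_fun
  (fun u => \sum_(j <oo) (pois (b * t) j * (l * pois (l * u) j))%:E)%E).
  by move=> u /set_mem/D0 u0; rewrite /= inverse_densityE.
apply: ge0_emeasurable_sum => j.
  by move=> u /D0 u0 _; rewrite lee_fin !(pois_ge0,mulr_ge0).
move=> _; apply/measurable_EFinP; apply: measurable_funM => //.
by apply: measurable_funM => //; exact: measurable_pois.
Qed.

Lemma ge0_integral_inverse_density l b t (D : set R) (g : R -> R) : 0 <= l ->
    0 <= b -> 0 <= t -> measurable D -> D `<=` `[0, +oo[ ->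
    measurable_fun D g -> (forall u, 0 <= u -> 0 <= g u) ->
  (\int[lebesgue_measure]_(u in D) (g u * inverse_density l b t u)%:E =
   \sum_(j <oo) (pois (b * t) j)%:E *
     \int[lebesgue_measure]_(u in D) (g u * (l * pois (l * u) j))%:E)%E.
Proof.
move=> l0 b0 t0 mD D0 mg g0.
have {}D0 u : D u -> 0 <= u by move=> /D0; rewrite /= in_itv/= andbT.
under eq_integral => u /set_mem/D0 u0.
  rewrite EFinM inverse_densityE// -nneseriesZl/= => [|n _]; last first.
    by rewrite lee_fin !(pois_ge0,mulr_ge0).
  over.
have mp j : measurable_fun D (fun u => g u * (l * pois (l * u) j)).
  by do 2 apply: measurable_funM => //; exact: measurable_pois.
rewrite integral_nneseries//.
- apply: eq_eseriesr => j _; rewrite -ge0_integralZl_EFin//.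
  + by apply: eq_integral => u _; rewrite -!EFinM; congr EFin; ring.
  + by move=> u /D0 u0; rewrite lee_fin !(pois_ge0,mulr_ge0,g0).
  + by apply/measurable_EFinP; exact: mp.
  + by rewrite pois_ge0// mulr_ge0.
- move=> j; apply/measurable_EFinP.
  apply: measurable_funM => //; apply: measurable_funM => //.
  by apply: measurable_funM => //; exact: measurable_pois.
- by move=> j u /D0 u0; rewrite lee_fin !(pois_ge0,mulr_ge0,g0).
Qed.

(** The [j]-th Erlang law gives [[0, u]] the probability that a Poisson variable of mean [l * u]
    exceeds [j]; exchanging the sums collects the indices [j < n]. *)
Lemma integral_inverse_density_itv l b t u : 0 <= l -> 0 <= b -> 0 <= t ->
    0 <= u ->
  (\int[lebesgue_measure]_(v in `[0%R, u]) (inverse_density l b t v)%:E =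
   \sum_(n <oo) (pois (l * u) n * \sum_(j < n) pois (b * t) j)%:E)%E.
Proof.
move=> l0 b0 t0 u0.
have pb0 j : 0 <= pois (b * t) j by rewrite pois_ge0// mulr_ge0.
have pl0 n : 0 <= pois (l * u) n by rewrite pois_ge0// mulr_ge0.
under eq_integral do rewrite -[inverse_density _ _ _ _]mul1r.
rewrite ge0_integral_inverse_density//; last first.
  by move=> v /=; rewrite !in_itv/= andbT => /andP[].
transitivity (\sum_(j <oo) \sum_(n <oo)
    (pois (b * t) j * ((j < n)%N%:R * pois (l * u) n))%:E)%E.
  apply: eq_eseriesr => j _; under eq_integral do rewrite mul1r.
  rewrite integral_pois// -nneseries_pois_tail ?mulr_ge0//.
  by rewrite -nneseriesZl// => n _; rewrite lee_fin mulr_ge0.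
rewrite nneseries_interchange => [|j n];
  last by rewrite lee_fin mulr_ge0// mulr_ge0.
apply: eq_eseriesr => n _.
rewrite (nneseries_split 0 n) => [|j _];
  last by rewrite lee_fin mulr_ge0// mulr_ge0.
rewrite eseries0 => [|j nj _]; last by rewrite ltnNge nj mul0r mulr0.
rewrite adde0 big_mkord sumEFin mulr_sumr; congr EFin; apply: eq_bigr => j _.
by rewrite ltn_ord mul1r mulrC.
Qed.

(* Exponential tilting turns the weights [pois (l * u)] into [pois (c * u)]
   with [c = l + a]. *)
Lemma integral_exp_inverse_density l b t a : 0 < l -> 0 <= b -> 0 <= t ->
    0 < l + a ->
  (\int[lebesgue_measure]_(u in `[0%R, +oo[)
     (expR (- a * u) * inverse_density l b t u)%:E)%E =
  (l / (l + a) * expR (- (b * t) * (a / (l + a))))%:E.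
Proof.
move=> l0 b0 t0 c0; set c := l + a; have lc0 : 0 < l / c by rewrite divr_gt0.
have bt0 : 0 <= b * t by rewrite mulr_ge0.
rewrite ge0_integral_inverse_density ?(ltW l0)//;
  last exact: measurable_exp_mull.
(* The [j]-th Erlang integral is [(l / c) ^+ j.+1]. Written with [ln (l / c)], its power turns the
   Poisson sum into an exponential moment. *)
transitivity (\sum_(j <oo) (l / c)%:E *
    (expR (ln (l / c) * j%:R) * pois (b * t) j)%:E)%E.
  apply: eq_eseriesr => j _.
  rewrite (_ : (\int[_]_(u in _) _)%E = ((l / c) ^+ j.+1)%:E).
    by rewrite -!EFinM expRM_natr lnK// exprS; congr EFin; ring.
  transitivity (\int[lebesgue_measure]_(u in `[0%R, +oo[)
     (((l / c) ^+ j.+1)%:E * (c * pois (c * u) j)%:E))%E.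
    apply: eq_integral => u _; rewrite -EFinM; congr EFin.
    have -> : expR (- a * u) * (l * pois (l * u) j) =
        l * ((l * u) ^+ j / j`!%:R) * (expR (- a * u) * expR (- (l * u))).
      by rewrite /pois; ring.
    rewrite -expRD (_ : - a * u + - (l * u) = - (c * u)); last by rewrite /c;
      ring.
    rewrite /pois expr_div_n !exprS !exprMn; field.
    by rewrite natr_fact_neq0 expf_neq0 ?gt_eqF.
  rewrite ge0_integralZl//.
  - by rewrite integral_pois_pinfty// mule1.
  - by apply/measurable_EFinP; apply: measurable_funM => //;
      exact: measurable_pois.
  - move=> u; rewrite /= in_itv/= andbT => u0.
    by rewrite lee_fin !(pois_ge0,mulr_ge0)// ltW.
  - by rewrite lee_fin exprn_ge0// ltW.
rewrite nneseriesZl/= => [|j _]; last by rewrite lee_fin mulr_ge0 ?expR_ge0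
  ?pois_ge0.
rewrite nneseries_exp_tilt// lnK// -EFinM; congr (_ * expR _)%:E.
by rewrite (_ : l = c - a) /c; [field; rewrite gt_eqF|ring].
Qed.

Lemma integral_inverse_density l b t : 0 < l -> 0 <= b -> 0 <= t ->
  (\int[lebesgue_measure]_(u in `[0%R, +oo[) (inverse_density l b t u)%:E)%E =
  1%E.
Proof.
move=> l0 b0 t0; have := @integral_exp_inverse_density l b t 0 l0 b0 t0.
rewrite addr0 divff ?gt_eqF// mul0r mulr0 expR0 mulr1 => <- //.
by apply: eq_integral => u _; rewrite oppr0 mul0r expR0 mul1r.
Qed.

(** The term [j = 0] of the mixture suffices: after tilting it is [C * expR (- (l + a) * u)], which
    is at least the positive constant [C] on the whole half-line. *)
Lemma integral_exp_inverse_density_pinfty l b t a : 0 < l -> 0 <= b -> 0 <= t ->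
    l + a < 0 ->
  (\int[lebesgue_measure]_(u in `[0%R, +oo[)
     (expR (- a * u) * inverse_density l b t u)%:E)%E = +oo%E.
Proof.
move=> l0 b0 t0 c0; pose C := l * expR (- (b * t)).
have C0 : 0 < C by rewrite mulr_gt0 ?expR_gt0.
have D0 : (`[0, +oo[ : set R) `<=` `[0, +oo[ by [].
have mI : measurable (`[0, +oo[ : set R) by [].
apply/eqP; rewrite -leye_eq.
rewrite (_ : +oo%E = (\int[lebesgue_measure]_(u in `[0%R, +oo[) C%:E)%E);
  last first.
  rewrite integral_cst//= lebesgue_measure_itv/= ltry.
  by rewrite /= gt0_muley ?lte_fin.
apply: ge0_le_integral => //.
- by move=> u _; rewrite lee_fin ltW.
- apply/measurable_EFinP; apply: measurable_funM.
    exact: measurable_exp_mull.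
  exact: measurable_inverse_density (ltW l0) b0 t0 mI D0.
- move=> u; rewrite /= in_itv/= andbT => u0; rewrite lee_fin.
  have term0 : pois (b * t) 0 * (l * pois (l * u) 0) <= inverse_density l b t u.
    have t_ge0 n : (0 <= (pois (b * t) n * (l * pois (l * u) n))%:E)%E.
      by rewrite lee_fin !(pois_ge0,mulr_ge0)// ltW.
    rewrite -lee_fin inverse_densityE ?(ltW l0)// (nneseries_split 0 1)//.
    by rewrite big_nat1 leeDl// nneseries_ge0.
  apply: le_trans (ler_wpM2l (expR_ge0 _) term0).
  rewrite /pois !expr0 fact0 !divr1 !mul1r.
  rewrite [leRHS](_ : _ = C * expR (- (l + a) * u)); last first.
    rewrite (_ : - (l + a) * u = - a * u + - (l * u)); last by ring.
    by rewrite expRD /C; ring.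
  rewrite ler_peMr ?(ltW C0)// -expR0 ler_expR mulNr oppr_ge0.
  by rewrite mulr_le0_ge0// ltW.
Qed.

End Bessel.

(** * Sums of exponential variables *)

Section Probability.
Context (d : measure_display) (T : measurableType d) (R : realType).
Variable P : probability T R.

Lemma g_sigma_algebra_preimageP (d' : measure_display) (T' : measurableType d')
    (X : T -> T') (B : set T') :
  measurable B -> g_sigma_algebra_preimage X (X @^-1` B).
Proof. by move=> mB; exists B => //; rewrite setTI. Qed.

Lemma measurable_g_sigma_algebra_preimage (d' : measure_display)
    (T' : measurableType d') (X : T -> T') (A : set T) :
  measurable_fun setT X -> g_sigma_algebra_preimage X A -> measurable A.
Proof. by move=> mX [B mB <-]; exact: mX. Qed.

Lemma eq_probability (A B N : set T) : measurable A -> measurable B ->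
  measurable N -> P N = 0%E -> (forall w, ~ N w -> A w <-> B w) -> P A = P B.
Proof.
move=> mA mB mN N0 AB.
have PD C : measurable C -> P C = P (C `\` N).
  move=> mC; have := measureDI P mC mN.
  rewrite [X in (_ + X)%E](_ : _ = 0%E) ?adde0//.
  by apply: subset_measure0 N0 => //; exact: measurableI.
rewrite (PD A)// (PD B)//; congr (P _).
by apply/seteqP; split=> w [Cw Nw]; split=> //; apply/AB.
Qed.

End Probability.

Definition jump_sum (T : Type) (R : realType) (xi : nat -> T -> R) (n : nat)
  (w : T) : R := \sum_(j < n) xi j w.

(* For [n = 0] this is the distribution function of the unit mass at 0. *)
Definition erlang_cdf (R : realType) (beta : R) (n : nat) (t : R) : R :=
  if t < 0 then 0 else pois_tail (beta * t) n.

Lemma measurable_erlang_cdf (R : realType) (beta : R) n :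
  measurable_fun setT (erlang_cdf beta n).
Proof.
rewrite /erlang_cdf; apply: measurable_fun_ifT => //.
  exact: measurable_fun_ltr.
by apply: continuous_measurable_fun; exact: continuous_pois_tail.
Qed.

Section JumpSum.
Context (d : measure_display) (T : measurableType d) (R : realType).
Variables (P : probability T R) (beta : R) (xi : nat -> T -> R).
Hypothesis beta_gt0 : 0 < beta.
Hypothesis hxi : iid_exponential P beta xi.

Lemma measurable_jump_sum n : measurable_fun setT (jump_sum xi n).
Proof.
apply: measurable_sum => j; exact: exponential_measurable hxi j.
Qed.

Lemma measurable_jump_sum_le n t : measurable [set w | jump_sum xi n w <= t].
Proof.
rewrite (_ : [set w | _] = setT `&` jump_sum xi n @^-1` `]-oo, t]).
  by apply: measurable_jump_sum.
by rewrite setTI; apply/seteqP; split=> w; rewrite /= in_itv.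
Qed.

Lemma jump_itv n a b : 0 <= a -> P (xi n @^-1` `]a, b]) =
  (\int[lebesgue_measure]_(x in `]a, b]) (beta * expR (- beta * x))%:E)%E.
Proof.
move=> a0; rewrite (exponential_law hxi)// /exponential_prob.
apply: eq_integral => x; rewrite inE/= in_itv/= => /andP[/ltW ax _].
by rewrite exponential_pdfE// (le_trans a0).
Qed.

Lemma jump_le0 n : P (xi n @^-1` `]-oo, 0]) = 0%E.
Proof.
rewrite (exponential_law hxi)// /exponential_prob -integral_itv_bndo_bndc.
  apply: integral0_eq => x; rewrite /= in_itv/= => x0.
  by rewrite lt0_exponential_pdf.
apply/measurable_EFinP/measurable_funTS; exact: measurable_exponential_pdf.
Qed.

Lemma erlang_cdf_convolution n t :
  (\int[lebesgue_measure]_(x in `]0%R, +oo[)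
    ((erlang_cdf beta n (t - x))%:E * (beta * expR (- beta * x))%:E))%E =
  (erlang_cdf beta n.+1 t)%:E.
Proof.
have [t0|t0] := ltP t 0.
  rewrite /erlang_cdf t0; apply: integral0_eq => x.
  rewrite /= in_itv/= andbT => x0.
  by rewrite ifT ?mul0e// subr_lt0 (lt_trans t0).
pose g x := (pois_tail (beta * (t - x)) n * (beta * expR (- beta * x)))%:E.
(* Since [erlang_cdf] vanishes at negative arguments, the integration stops at [t]. *)
transitivity (\int[lebesgue_measure]_(x in `]0%R, +oo[)
    (g \_ (`]-oo, t] : set R)) x)%E.
  apply: eq_integral => x _; rewrite /erlang_cdf patchE subr_lt0.
  case: ifPn => [|]; last first.
    by rewrite -leNgt => xt; rewrite ifT// inE/= in_itv.
  by rewrite ltNge => /negbTE xt; rewrite ifF ?mul0e// mem_setE/= in_itv.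
rewrite -integral_mkcondr.
rewrite (_ : _ `&` _ = `]0, t]%classic); last first.
  apply/seteqP; split=> x /=; rewrite !in_itv/= andbT; first by case=> -> ->.
  by case/andP.
rewrite integral_itv_obnd_cbnd; last first.
  apply/measurable_EFinP; apply: measurable_funM; last first.
    by apply: measurable_funM => //; exact: measurable_exp_mull.
  apply: measurable_funTS.
  apply: (@measurableT_comp _ _ _ _ _ _ (fun x => pois_tail (beta * x) n)) =>
    //.
    by apply: continuous_measurable_fun; exact: continuous_pois_tail.
  exact: measurable_funB.
by rewrite /erlang_cdf ltNge t0; exact: integral_pois_tail_exponential.
Qed.

(** The induction closes because events of jumps of index at least [n] are carried along: in the
    inductive step the event that [xi n] lies in an interval joins the list, which yields the
    independence of the partial sum and [xi n] required by the randomization. *)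
Lemma prob_jump_sum_le_bigI n t (s : seq nat) (A : nat -> set T) : uniq s ->
    (forall i, i \in s -> (n <= i)%N) ->
    (forall i, i \in s -> g_sigma_algebra_preimage (xi i) (A i)) ->
  P ([set w | jump_sum xi n w <= t] `&` \big[setI/setT]_(i <- s) A i) =
  ((erlang_cdf beta n t)%:E * \prod_(i <- s) P (A i))%E.
Proof.
elim: n t s A => [|n IHn] t s A us ns sA.
  rewrite -(exponential_independent hxi us sA) /erlang_cdf /pois_tail big_ord0.
  rewrite subr0 ltNge; case: (boolP (0 <= t)) => t0 /=.
    rewrite mul1e; congr (P _); rewrite -[RHS]setTI; congr (_ `&` _).
    by apply/seteqP; split=> // w _; rewrite /jump_sum/= big_ord0.
  rewrite mul0e (_ : [set w | _] = set0) ?set0I//.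
  by apply/seteqP; split=> // w; rewrite /jump_sum/= big_ord0; exact/negP.
set AI := \big[setI/setT]_(i <- s) A i.
have mAI : measurable AI.
  rewrite /AI big_seq; apply: bigsetI_measurable => i /sA.
  apply: measurable_g_sigma_algebra_preimage;
    exact: exponential_measurable hxi i.
have mxi := exponential_measurable hxi n.
pose Z u := [set w | jump_sum xi n w <= t - u] `&` AI.
have ns' i : i \in s -> (n <= i)%N by move/ns/ltnW.
have [|||u _|u a b u0 a0 ab|w y y0|] := @probability_randomization _ _ _ P
    (xi n) (fun x => beta * expR (- beta * x)) Z false mxi.
- by apply: measurable_funM => //; exact: measurable_exp_mull.
- by move=> u u0; rewrite mulr_ge0 ?expR_ge0// ltW.
- by move=> a b a0 _; exact: jump_itv.
- by apply: measurableI => //; exact: measurable_jump_sum_le.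
- rewrite [in RHS](IHn _ _ _ us ns' sA).
  pose A' i := if i == n then xi n @^-1` `]a, b] else A i.
  have nns : n \notin s by apply/negP => /ns; rewrite ltnn.
  have A's i : i \in s -> A' i = A i.
    by rewrite /A'; case: eqP => // -> /(negP nns).
  have A'n : A' n = xi n @^-1` `]a, b] by rewrite /A' eqxx.
  have := IHn (t - u) (n :: s) A'; rewrite !big_cons A'n.
  rewrite [X in P (_ `&` (_ `&` X))](_ : _ = AI); last first.
    by rewrite /AI big_seq [RHS]big_seq; apply: eq_bigr => i /A's ->.
  rewrite [X in (_ * (_ * X))%E](_ : _ = \prod_(i <- s) P (A i))%E; last first.
    by rewrite big_seq [RHS]big_seq; apply: eq_bigr => i /A's ->.
  rewrite setICA setIC muleCA muleC => -> //=.
  - by rewrite nns.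
  - by move=> i; rewrite inE => /predU1P[->//|/ns'].
  - move=> i; rewrite inE => /predU1P[->|/[dup] ? /A's ->]; last exact: sA.
    rewrite A'n; exact: g_sigma_algebra_preimageP.
(* Decreasing the time weakens the condition: if it holds at [y] it persists, and if it fails it
   keeps failing within the margin taken as [e]. *)
- have [Sle|Slt] := leP (jump_sum xi n w) (t - y).
    exists 1 => // v _ /andP[_ vy]; split=> -[_ Aw]; split=> //=.
    by rewrite (le_trans Sle)// lerD2l lerN2 ltW.
  exists (jump_sum xi n w - (t - y)); first by rewrite subr_gt0.
  move=> v _ /andP[yv vy]; split=> -[/= Sle Aw]; split=> //=.
    lra.
  lra.
move=> mE PE.
have -> : P ([set w | jump_sum xi n.+1 w <= t] `&` AI) =
    P [set w | 0 < xi n w /\ Z (xi n w) w].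
  apply: (eq_probability _ _ _ (jump_le0 n)) => //.
  + by apply: measurableI => //; exact: measurable_jump_sum_le.
  + by rewrite -[X in measurable X]setTI; exact: mxi.
  + move=> w /=; rewrite in_itv/= => /negP; rewrite -ltNge => xi0.
    rewrite /Z /jump_sum/= big_ord_recr/= lerBrDr.
    by split=> [[]|[_ []]].
rewrite PE -erlang_cdf_convolution.
under eq_integral do rewrite (IHn _ _ _ us ns' sA) muleAC.
rewrite ge0_integralZr//.
- apply: emeasurable_funM; apply/measurable_EFinP.
    apply: (@measurableT_comp _ _ _ _ _ _ (erlang_cdf beta n)) => //.
      exact: measurable_erlang_cdf.
    exact: measurable_funB.
  by apply: measurable_funM => //; exact: measurable_exp_mull.
(* [erlang_cdf] is nonnegative because the induction hypothesis exhibits it as a probability. *)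
- move=> u _; have := IHn (t - u) [::] A isT.
  rewrite !big_nil mule1 setIT => <- //; rewrite mule_ge0// lee_fin.
  by rewrite mulr_ge0 ?expR_ge0 ?(ltW beta_gt0).
- by apply: prode_ge0 => i _.
Qed.

Lemma prob_jump_sum_le n t :
  P [set w | jump_sum xi n w <= t] = (erlang_cdf beta n t)%:E.
Proof.
have := @prob_jump_sum_le_bigI n t [::] (fun=> setT) isT.
by rewrite !big_nil mule1 setIT; apply.
Qed.

End JumpSum.

(** * The inverse process *)

Section Independence.
Context (d : measure_display) (T : measurableType d) (R : realType).
Variable P : probability T R.

Lemma independent2E (F G : set (set T)) (A B : set T) :
  independent2 P F G -> F A -> G B -> P (A `&` B) = (P A * P B)%E.
Proof.
move=> FG FA GB.
have := FG [:: ord0; ord_max] (fun i => if i == ord0 then A else B) isT.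
rewrite !big_cons !big_nil /= setIT mule1; apply => i.
by rewrite !inE => /orP[|] /eqP ->.
Qed.

Lemma independent3E (F G H : set (set T)) (A B C : set T) :
    independent3 P F G H -> F A -> G B -> H C ->
  [/\ P (A `&` B) = (P A * P B)%E &
      P (A `&` B `&` C) = (P A * P B * P C)%E].
Proof.
move=> FGH FA GB HC.
pose i1 : 'I_3 := Ordinal (isT : (1 < 3)%N).
pose D (i : 'I_3) := if i == ord0 then A else if i == i1 then B else C.
split.
  have := FGH [:: ord0; i1] D isT.
  rewrite !big_cons !big_nil /= setIT mule1; apply => i.
  by rewrite !inE => /orP[|] /eqP ->.
have := FGH [:: ord0; i1; ord_max] D isT.
rewrite !big_cons !big_nil /= setIT mule1 setIA muleA; apply => i.
by rewrite !inE => /or3P[|| ] /eqP ->.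
Qed.

Lemma process_sigma_preimage (d' : measure_display) (T' : measurableType d')
    (X : R -> T -> T') (t : R) (B : set T') :
  0 <= t -> measurable B -> process_sigma X (X t @^-1` B).
Proof.
move=> t0 mB; apply: sub_sigma_algebra; exists t => //.
exact: g_sigma_algebra_preimageP.
Qed.

End Independence.

(** * Poisson processes: law at a fixed time and local constancy of paths *)

Section PoissonProcess.
Context (d : measure_display) (T : measurableType d) (R : realType).
Variables (P : probability T R) (l : R) (N : R -> T -> nat).
Hypothesis l_gt0 : 0 < l.
Hypothesis hN : poisson_process P l N.

Lemma measurable_poisson_preimage u (B : set nat) : 0 <= u ->
  measurable (N u @^-1` B).
Proof.
by move=> u0; rewrite -[X in measurable X]setTI;
  apply: (poisson_measurable hN u0).
Qed.

Lemma poisson_law u n : 0 <= u -> P (N u @^-1` [set n]) = (pois (l * u) n)%:E.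
Proof.
rewrite le_eqVlt => /predU1P[<-|u0].
  rewrite mulr0 pois0; have [->|n0] := eqVneq n 0%N.
    rewrite (_ : _ @^-1` _ = setT) ?probability_setT//.
    by apply/seteqP; split=> // w _ /=; rewrite (poisson_start hN).
  rewrite (_ : _ @^-1` _ = set0) ?measure0//.
  apply/seteqP; split=> // w /=; rewrite (poisson_start hN) => n0'.
  by rewrite -n0' eqxx in n0.
rewrite -poisson_pmfE ?mulr_gt0// -[u in RHS]subr0.
rewrite -(poisson_increments hN _ (lexx 0) u0); congr (P _).
by apply/seteqP; split=> w /=; rewrite (poisson_start hN) subn0.
Qed.

(** Natural numbers at distance less than 1 coincide, so right continuity amounts to constancy on a
    right neighbourhood. *)
Lemma poisson_right_cst w (u : R) : 0 <= u -> exists2 e : R, 0 < e &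
  forall v : R, u <= v < u + e -> N v w = N u w.
Proof.
move=> u0; have := @poisson_right_continuous _ _ _ _ _ _ hN w u u0.
move/cvgrPdist_lt => /(_ 1 ltr01)[e /= e0 eN]; exists e => // v.
move=> /andP[]; rewrite le_eqVlt => /predU1P[<-//|uv vue].
have {eN} : `|(N u w)%:R - (N v w)%:R| < 1 :> R.
  apply: eN => //=; rewrite distrC ger0_norm ?subr_ge0 ?ltW//.
  by rewrite ltrBlDl.
rewrite distrC -natrB; last exact: (poisson_nondecreasing hN w u0 (ltW uv)).
rewrite normr_nat ltrn1 ltnS leqn0 subn_eq0 => Nvu; apply/eqP;
  rewrite eqn_leq Nvu/=.
exact: (poisson_nondecreasing hN w u0 (ltW uv)).
Qed.

End PoissonProcess.

Section InverseProcess.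
Context (d : measure_display) (T : measurableType d) (R : realType).
Variables (P : probability T R) (lambda beta : R).
Variables (N : R -> T -> nat) (xi : nat -> T -> R).
Hypothesis lambda_gt0 : 0 < lambda.
Hypothesis beta_gt0 : 0 < beta.
Hypothesis hE : compound_poisson_exponential P lambda beta N xi.

Let hN : poisson_process P lambda N := compound_poisson hE.
Let hxi : iid_exponential P beta xi := compound_jumps hE.
Let E := compound_sum N xi.
Let Y := inverse_process E.

Let EE u w : E u w = jump_sum xi (N u w) w. Proof. by []. Qed.

Let exceed t u := [set w | t < E u w].

Let exceedE t u : exceed t u = \bigcup_n
  (N u @^-1` [set n] `&` [set w | t < jump_sum xi n w]).
Proof.
apply/seteqP; split=> [w tE|w [n _ [/= Nn tE]]]; first by exists (N u w).
by rewrite /exceed /= EE Nn.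
Qed.

Let measurable_jump_sum_gt t n : measurable [set w | t < jump_sum xi n w].
Proof.
rewrite (_ : [set w | _] = ~` [set w | jump_sum xi n w <= t]).
  by apply: measurableC; exact: (measurable_jump_sum_le hxi).
by apply/seteqP; split=> w /=; rewrite ltNge => /negP.
Qed.

Let mexceed_piece t u n : 0 <= u ->
  measurable (N u @^-1` [set n] `&` [set w | t < jump_sum xi n w]).
Proof.
by move=> u0; apply: measurableI => //; exact: (measurable_poisson_preimage hN).
Qed.

Lemma measurable_exceed t u : 0 <= u -> measurable [set w | t < E u w].
Proof.
move=> u0; rewrite -/(exceed t u) exceedE; apply: bigcupT_measurable => n.
exact: mexceed_piece.
Qed.

Let jump_sum_sigma t n :
  generated_sigma_algebra setT xi [set w | t < jump_sum xi n w].
Proof.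
(* With [T] equipped with the sigma-algebra generated by the jumps, measurability of a finite sum is
   the required membership. *)
pose G := \bigcup_(j in [set: nat]) g_sigma_algebra_preimage (xi j).
have := @measurable_sum _ (g_sigma_algebraType G) R setT _ (index_enum 'I_n)
  (fun j w => xi j w) _ measurableT `]t, +oo[%classic (measurable_itv _).
rewrite (_ : setT `&` _ = [set w | t < jump_sum xi n w]); last first.
  by rewrite setTI; apply/seteqP; split=> w; rewrite /= in_itv/= andbT.
apply => j _ B mB; apply: sub_sigma_algebra; exists (val j) => //.
by exists B => //; rewrite setTI.
Qed.

Lemma prob_exceed t u : 0 <= t -> 0 <= u -> P [set w | t < E u w] =
  (\int[lebesgue_measure]_(v in `[0%R, u])
     (inverse_density lambda beta t v)%:E)%E.
Proof.
move=> t0 u0; rewrite -/(exceed t u) exceedE measure_semi_bigcup; last 3 first.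
- by move=> n; exact: mexceed_piece.
- by move=> i j _ _ [w /= [[/= <- _] [/= <- _]]].
- by apply: bigcupT_measurable => n; exact: mexceed_piece.
rewrite (integral_inverse_density_itv (ltW lambda_gt0) (ltW beta_gt0) t0 u0);
  apply: eq_eseriesr => n _.
transitivity (P (N u @^-1` [set n]) * P [set w | (t < jump_sum xi n w)%R])%E.
  apply: (independent2E (compound_independent hE)); last exact: jump_sum_sigma.
  exact: process_sigma_preimage.
rewrite (poisson_law lambda_gt0 hN)//.
suff -> : P [set w | t < jump_sum xi n w] = (\sum_(j < n) pois (beta * t) j)%:E.
  by [].
rewrite (_ : [set w | _] = ~` [set w | jump_sum xi n w <= t]); last first.
  by apply/seteqP; split=> w /=; rewrite ltNge => /negP.
rewrite probability_setC; last exact: (measurable_jump_sum_le hxi).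
rewrite (prob_jump_sum_le beta_gt0 hxi) -EFinB /erlang_cdf ltNge t0 /=.
by rewrite /pois_tail opprB addrCA subrr addr0.
Qed.

Let hits t w := [set u : R | 0 <= u /\ t < E u w].

Let YE t w : Y t w = inf (hits t w). Proof. by []. Qed.

Let has_lbound_hits t w : has_lbound (hits t w).
Proof. by exists 0 => u []. Qed.

Lemma inverse_process_ge0 t w : 0 <= Y t w.
Proof.
rewrite YE; have [->|h0] := eqVneq (hits t w) set0; first by rewrite inf0.
by apply: lb_le_inf => [|u []//]; exact/set0P.
Qed.

Let E_right_cst w u : 0 <= u -> exists2 e : R, 0 < e &
  forall v : R, u <= v < u + e -> E v w = E u w.
Proof.
move=> u0; have [e e0 eN] := poisson_right_cst hN w u0.
by exists e => // v uv; rewrite !EE eN.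
Qed.

(** Right-sided constancy of [E] moves a hit to a nearby grid point, so countably many times decide
    whether [Y t w < u]; this gives the measurability of [Y t]. *)
Let hits_grid t w u v : hits t w v -> v < u -> exists n j,
  grid_point R false n j < u /\ t < E (grid_point R false n j) w.
Proof.
move=> [v0 tv] vu.
have [v_eq0|v_neq0] := eqVneq v 0.
  exists 0%N, 0%N; rewrite /grid_point/= mul0r.
  by rewrite -v_eq0.
have {v_neq0} v_gt0 : 0 < v by rewrite lt_neqAle eq_sym v_neq0.
have [e e0 Ee] := E_right_cst w v0.
have m0 : 0 < Num.min e (u - v) by rewrite lt_min e0 subr_gt0.
have [n _ /(_ n (leqnn n))/= /andP[vg]] := near_grid_point true v_gt0 m0.
set g := grid_point R true n (grid_cell n v) in vg *.
rewrite -ltrBlDl lt_min => /andP[ge gu].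
(* The right endpoint of a cell is the left endpoint of the next one. *)
exists n, (grid_cell n v).+1.
have -> : grid_point R false n (grid_cell n v).+1 = g.
  by rewrite /g /grid_point addn0 addn1.
have gE : E g w = E v w by apply: Ee; rewrite vg/= -ltrBlDl.
by rewrite gE; split=> //; rewrite -(ltrD2r (- v)).
Qed.

Lemma measurable_inverse_process t : measurable_fun setT (Y t).
Proof.
move=> _; apply: (measurability _ (RGenInftyO.measurableE R)) => //.
move=> _ [_ [u ->] <-]; rewrite setTI.
pose A n j := [set w | t < E (grid_point R false n j) w].
have mA n j : measurable (A n j) by apply: measurable_exceed;
  exact: grid_point_ge0.
(* The second part is the event that [t] is never exceeded, where the infimum takes its default
   value 0. *)
rewrite (_ : _ @^-1` _ =
  (\bigcup_n \bigcup_(j in [set j | grid_point R false n j < u]) A n j) `|`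
  (~` (\bigcup_n \bigcup_j A n j) `&` [set w | 0 < u])).
  apply: measurableU.
    by apply: bigcupT_measurable => n; exact: bigcup_measurable.
  apply: measurableI.
    apply/measurableC/bigcupT_measurable => n; exact: bigcupT_measurable.
  have [u0|u0] := ltP 0 u.
    by rewrite (_ : [set _ | _] = setT)//; apply/seteqP; split.
  by rewrite (_ : [set _ | _] = set0)//; apply/seteqP; split.
apply/seteqP; split=> [w|w].
  rewrite /= in_itv/= YE => Yu.
  have [/set0P h0|h0] := boolP (hits t w != set0).
    have [v hv vu] := inf_lt h0 Yu.
    by have [n [j [gu tE]]] := hits_grid hv vu; left; exists n => //; exists j.
  move: h0; rewrite negbK => /eqP h0; right; split;
    last by rewrite -[0](inf0 R) -h0.
  move=> [n _ [j _ Anj]]; suff : hits t w (grid_point R false n j) by rewrite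
    h0.
  by split => //; exact: grid_point_ge0.
rewrite /= in_itv/= => -[[n _ [j /= gu Anj]]|[/= nA u0]].
  apply: le_lt_trans gu; rewrite YE; apply: (ge_inf (has_lbound_hits t w)).
  by split=> //; exact: grid_point_ge0.
rewrite YE (_ : hits t w = set0) ?inf0//.
apply/seteqP; split=> // v hv; apply: nA.
have [n [j [_ tE]]] := hits_grid hv (ltr_pwDr ltr01 (lexx v)).
by exists n => //; exists j.
Qed.

Let never t := \bigcap_m (~` exceed t m%:R).

Let measurable_never t : measurable (never t).
Proof.
apply: bigcapT_measurable => m; apply: measurableC.
by apply: measurable_exceed; exact: ler0n.
Qed.

Let measurable_density t (D : set R) : 0 <= t -> measurable D ->
  D `<=` `[0, +oo[ -> measurable_fun D (EFin \o inverse_density lambda beta t).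
Proof.
move=> t0 mD D0; apply/measurable_EFinP.
exact: measurable_inverse_density (ltW lambda_gt0) (ltW beta_gt0) t0 mD D0.
Qed.

Let density_ge0 t v : 0 <= t -> 0 <= v ->
  (0 <= (inverse_density lambda beta t v)%:E)%E.
Proof.
move=> t0 v0; rewrite lee_fin.
exact: inverse_density_ge0 (ltW lambda_gt0) (ltW beta_gt0) t0 v0.
Qed.

(** The integral of the density up to an integer is the probability that [t] is exceeded by that
    time, hence at most [1 - P (never t)]; these integrals tend to 1. *)
Let prob_never t : 0 <= t -> P (never t) = 0%E.
Proof.
move=> t0; pose f := inverse_density lambda beta t.
have mex (m : nat) : measurable (exceed t m%:R) by exact: measurable_exceed.
have le_never m : (\int[lebesgue_measure]_(u in `[0%R, m.+1%:R]) (f u)%:E <=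
    1 - P (never t))%E.
  rewrite -prob_exceed// leeBrDr ?fin_num_measure//.
  have := probability_setC P (mex m.+1).
  move/(congr1 (fun x => P (exceed t m.+1%:R) + x)%E).
  rewrite addeCA subee ?fin_num_measure ?adde0// => <-.
  rewrite leeD2l// le_measure ?inE//; first exact: measurableC.
  by move=> w /(_ m.+1 I).
have cvg_int : (\int[lebesgue_measure]_(u in `[0%R, m.+1%:R]) (f u)%:E)%E
    @[m --> \oo] --> 1%E.
  rewrite -(integral_inverse_density lambda_gt0 (ltW beta_gt0) t0).
  rewrite itv0y_bigcup0S.
  apply: ge0_nondecreasing_set_cvg_integral => //.
  - move=> m n mn; apply/subsetPset => v; rewrite /= !in_itv/= => /andP[-> vm].
    by rewrite (le_trans vm)// ler_nat.
  - move=> m; apply: measurable_density => // v.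
    by rewrite /= !in_itv/= andbT => /andP[].
  - by move=> m v; rewrite /= in_itv/= => /andP[v0 _]; exact: density_ge0.
have : (1 <= 1 - P (never t))%E.
  rewrite -[leLHS](cvg_lim _ cvg_int)//; apply: lime_le; first by apply/cvg_ex;
    exists 1%E.
  by apply: nearW => m; exact: le_never.
rewrite leeBrDr ?fin_num_measure// -[leRHS]adde0 leeD2lE// => P0.
by apply/eqP; rewrite eq_le P0 measure_ge0.
Qed.

Lemma prob_inverse_process_le t u : 0 <= t -> 0 <= u ->
  P (Y t @^-1` `]-oo, u]) =
  (\int[lebesgue_measure]_(v in `[0%R, u])
     (inverse_density lambda beta t v)%:E)%E.
Proof.
move=> t0 u0; rewrite -prob_exceed//.
(* Outside [B] the jumps are positive, so the path of [E] is nondecreasing, and the infimum is taken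
   over a nonempty set. *)
pose B := (\bigcup_j (xi j @^-1` `]-oo, 0])) `|` never t.
have mxi j : measurable (xi j @^-1` `]-oo, 0]).
  rewrite -[X in measurable X]setTI.
  by apply: (exponential_measurable hxi j) => //; exact: measurable_itv.
have mB : measurable B by apply: measurableU => //; exact: bigcupT_measurable.
apply: (@eq_probability _ _ _ P _ _ B) => //.
- rewrite -[X in measurable X]setTI.
  by apply: measurable_inverse_process => //; exact: measurable_itv.
- exact: measurable_exceed.
- rewrite null_set_setU//; first exact: bigcupT_measurable.
    apply/negligibleP; first exact: bigcupT_measurable.
    apply: negligible_bigcup => j; apply/negligibleP => //.
    exact: jump_le0 hxi j.
  exact: prob_never.
move=> w /not_orP[xi0 ntB]; rewrite /= in_itv/= YE.
have xi_ge0 j : 0 <= xi j w.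
  rewrite leNgt; apply/negP => xj0; apply: xi0; exists j => //=.
  by rewrite in_itv/= ltW.
split=> [Yu|tE]; last by apply: ge_inf.
have h0 : hits t w !=set0.
  apply: contrapT => h0; apply: ntB => m _ tE; apply: h0.
  by exists m%:R; split.
rewrite ltNge; apply/negP => Eut.
(* If [t] is not exceeded at [u], it is not exceeded before [u] by monotonicity nor on [[u, u + e[]
   by constancy, so the infimum is at least [u + e]. *)
have [e e0 Ee] := E_right_cst w u0.
suff : u + e <= u by rewrite gerDl leNgt e0.
apply: le_trans Yu; apply: lb_le_inf => // v [v0 tv].
rewrite leNgt; apply/negP => vue; move: tv; apply/negP; rewrite -leNgt.
have [uv|vu] := leP u v; first by rewrite Ee ?uv.
apply: le_trans Eut; rewrite !EE /jump_sum.
have Nvu := poisson_nondecreasing hN w v0 (ltW vu).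
rewrite -(big_mkord xpredT (fun j => xi j w)) -(big_mkord xpredT (fun j =>
  xi j w)).
by rewrite (big_cat_nat (leq0n _) Nvu)/= lerDl sumr_ge0.
Qed.

Lemma prob_inverse_process_le0 t : 0 <= t -> P (Y t @^-1` `]-oo, 0]) = 0%E.
Proof. by move=> t0; rewrite prob_inverse_process_le// set_itv1 integral_set1.
  Qed.

Lemma prob_inverse_process_itv t a b : 0 <= t -> 0 <= a -> a < b ->
  P (Y t @^-1` `]a, b]) =
  (\int[lebesgue_measure]_(v in `]a, b])
     (inverse_density lambda beta t v)%:E)%E.
Proof.
move=> t0 a0 ab; have b0 := le_trans a0 (ltW ab).
have mY B : measurable B -> measurable (Y t @^-1` B).
  move=> mB; rewrite -[X in measurable X]setTI.
  exact: measurable_inverse_process.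
have PU : P (Y t @^-1` `]-oo, b]) =
    (P (Y t @^-1` `]-oo, a]) + P (Y t @^-1` `]a, b]))%E.
  rewrite -measureU//; last 3 first.
  - by apply: mY; exact: measurable_itv.
  - by apply: mY; exact: measurable_itv.
  - rewrite -preimage_setI (_ : _ `&` _ = set0) ?preimage_set0//.
    apply/seteqP; split=> // v /= []; rewrite !in_itv/= => va /andP[av _].
    by have := lt_le_trans av va; rewrite ltxx.
  rewrite -preimage_setU; congr (P (_ @^-1` _)).
  apply/seteqP; split=> v /=; rewrite !in_itv/=.
    by case: (leP v a) => va vb; [left|right].
  by case=> [/le_trans->//|/andP[]//]; exact: ltW.
have : (P (Y t @^-1` `]-oo, a]) \is a fin_num).
  by rewrite fin_num_measure//; apply: mY; exact: measurable_itv.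
move: PU; rewrite !prob_inverse_process_le//.
rewrite (_ : `[0, b]%classic = `[0, a]%classic `|` `]a, b]%classic); last first.
  apply/seteqP; split=> v /=; rewrite !in_itv/=.
    by case: (leP v a) => va /andP[-> vb]; [left|right].
  case=> /andP[]; first by move=> -> /le_trans->//; exact: ltW.
  by move=> /ltW/(le_trans a0) -> ->.
have ge0U v : (`[0, a] `|` `]a, b]) v -> 0 <= v.
  rewrite /= !in_itv/= => -[/andP[]//|/andP[/ltW av _]]; exact: le_trans av.
have addeI (A B C : \bar R) : A \is a fin_num -> (A + B = A + C)%E -> C = B.
  by move=> fA H; rewrite -(addeK C fA) (addeC C) -H (addeC A) addeK.
rewrite ge0_integral_setU//.
- move=> H fin; exact: addeI fin H.
- apply: measurable_density => //; first exact: measurableU.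
  by move=> v /ge0U; rewrite /= in_itv/= andbT.
- by move=> v /ge0U; exact: density_ge0.
- apply/disj_setPS => v /= []; rewrite !in_itv/= => /andP[_ va] /andP[av _].
  by have := lt_le_trans av va; rewrite ltxx.
Qed.

End InverseProcess.

(** * The Skellam process *)

Lemma integral_countable_partition (d : measure_display) (T : measurableType d)
    (R : realType) (P : probability T R) (D : set T) (F : nat -> set T)
    (g : T -> R) (c : nat -> R) :
    (forall n, measurable (F n)) -> trivIset setT F -> D = \bigcup_n F n ->
    (forall w, 0 <= g w) -> (forall n w, F n w -> g w = c n) ->
  measurable_fun D g /\
  (\int[P]_(w in D) (g w)%:E = \sum_(n <oo) (c n)%:E * P (F n))%E.
Proof.
move=> mF tF -> g0 gc.
have mg : measurable_fun (\bigcup_n F n) g.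
  apply/measurable_fun_bigcup => // n.
  apply: (eq_measurable_fun (cst (c n))); last exact: measurable_cst.
  by move=> w /set_mem/gc.
split => //; rewrite ge0_integral_bigcup//; last 2 first.
- exact/measurable_EFinP.
- by move=> w _; rewrite lee_fin.
apply: eq_eseriesr => n _; rewrite -integral_cst//.
by apply: eq_integral => w /set_mem/gc ->.
Qed.

Section Skellam.
Context (d : measure_display) (T : measurableType d) (R : realType).
Variables (P : probability T R) (l1 l2 : R) (N1 N2 : R -> T -> nat).
Hypothesis l1_gt0 : 0 < l1.
Hypothesis l2_gt0 : 0 < l2.
Hypothesis hN1 : poisson_process P l1 N1.
Hypothesis hN2 : poisson_process P l2 N2.
Hypothesis N12 : forall u (A B : set nat), 0 <= u ->
  P (N1 u @^-1` A `&` N2 u @^-1` B) = (P (N1 u @^-1` A) * P (N2 u @^-1` B))%E.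

Let S := skellam N1 N2.

(** Slicing by the value of [N2] turns an event on [S u] into a disjoint union of rectangles, to
    which independence applies. *)
Let piece (K : set int) u b :=
  N1 u @^-1` [set a | K (a%:Z - b%:Z)] `&` N2 u @^-1` [set b].

Let skellamE (K : set int) u : S u @^-1` K = \bigcup_b piece K u b.
Proof.
apply/seteqP; split=> [w Kw|w [b _ [/= Kw Nb]]]; first by exists (N2 u w).
by rewrite /preimage /S /skellam /= Nb.
Qed.

Let measurable_piece K u b : 0 <= u -> measurable (piece K u b).
Proof.
move=> u0; apply: measurableI.
  exact: (measurable_poisson_preimage hN1).
exact: (measurable_poisson_preimage hN2).
Qed.

Let trivIset_piece K u : trivIset setT (piece K u).
Proof. by move=> i j _ _ [w [[_ /= <-] [_ /= <-]]]. Qed.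

Lemma measurable_skellam K u : 0 <= u -> measurable (S u @^-1` K).
Proof.
by move=> u0; rewrite skellamE; apply: bigcupT_measurable => b;
  exact: measurable_piece.
Qed.

Lemma skellam_right_cst w (u : R) : 0 <= u -> exists2 e : R, 0 < e &
  forall v : R, u <= v < u + e -> S v w = S u w.
Proof.
move=> u0; have [e1 e10 E1] := poisson_right_cst hN1 w u0.
have [e2 e20 E2] := poisson_right_cst hN2 w u0.
exists (Num.min e1 e2); first by rewrite lt_min e10.
move=> v /andP[uv]; rewrite -ltrBlDl lt_min !ltrBlDl => /andP[ve1 ve2].
by rewrite /S /skellam E1 ?uv// E2 ?uv.
Qed.

Lemma prob_skellam_indep K (C : set T) u : 0 <= u -> measurable C ->
    (forall A B : set nat, P (N1 u @^-1` A `&` N2 u @^-1` B `&` C) =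
      (P (N1 u @^-1` A) * P (N2 u @^-1` B) * P C)%E) ->
  P (S u @^-1` K `&` C) = (P (S u @^-1` K) * P C)%E.
Proof.
move=> u0 mC NC; have mp b := measurable_piece K b u0.
have mU : measurable (\bigcup_b piece K u b) by exact: bigcupT_measurable.
have mpC b : measurable (piece K u b `&` C) by exact: measurableI.
rewrite skellamE setI_bigcupl measure_semi_bigcup//; last 2 first.
- by move=> i j _ _ [w [[[_ /= <-] _] [[_ /= <-] _]]].
- exact: bigcupT_measurable.
rewrite (measure_semi_bigcup P mp)//.
have PC := fin_num_measure P _ mC.
rewrite muleC -(fineK PC) -nneseriesZl/= => [|b _]; last exact: measure_ge0.
apply: eq_eseriesr => b _; rewrite fineK// [RHS]muleC.
by apply: etrans (NC _ _) _; rewrite -N12.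
Qed.

Lemma prob_skellam_ge0 u (k : nat) : 0 <= u -> P (S u @^-1` [set k%:Z]) =
  (\sum_(b <oo) (pois (l1 * u) (b + k) * pois (l2 * u) b)%:E)%E.
Proof.
move=> u0; rewrite skellamE measure_semi_bigcup//; last 2 first.
- by move=> b; exact: measurable_piece.
- by apply: bigcupT_measurable => b; exact: measurable_piece.
apply: eq_eseriesr => b _; rewrite /piece.
rewrite (_ : [set a | _] = [set (b + k)%N]); last first.
  by apply/seteqP; split=> a /=; lia.
by rewrite [LHS]N12// (poisson_law l1_gt0 hN1)// (poisson_law l2_gt0 hN2).
Qed.

(** Splitting by the values of both processes gives a double series of nonnegative terms, which
    factors into Poisson exponential moments at [eta] and [- eta]. *)
Lemma skellam_mgf u eta : 0 <= u ->
  (\int[P]_w (expR (eta * (S u w)%:~R))%:E)%E =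
  (expR (- (u * skellam_laplace_exponent l1 l2 (- eta))))%:E.
Proof.
move=> u0.
pose A a := N1 u @^-1` [set a]; pose B b := N2 u @^-1` [set b].
have mA a : measurable (A a) by exact: (measurable_poisson_preimage hN1).
have mB b : measurable (B b) by exact: (measurable_poisson_preimage hN2).
have tA : trivIset setT A by move=> i j _ _ [w [/= <- <-]].
have tAB a : trivIset setT (fun b => A a `&` B b).
  by move=> i j _ _ [w [[_ /= <-] [_ /= <-]]].
have AT : [set: T] = \bigcup_a A a.
  by apply/seteqP; split=> // w _; exists (N1 u w).
have AB a : A a = \bigcup_b (A a `&` B b).
  apply/seteqP; split=> [w Aw|w [b _ []]//]; by exists (N2 u w).
pose g w : R := expR (eta * (S u w)%:~R).
have g0 w : 0 <= g w by exact: expR_ge0.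
have gc a b w : (A a `&` B b) w -> g w = expR (eta * (a%:R - b%:R)).
  by rewrite /g /S /skellam => -[/= -> ->]; rewrite rmorphB.
have gA a := @integral_countable_partition _ _ _ P (A a) _ g
  (fun b => expR (eta * (a%:R - b%:R))) (fun b => measurableI _ _ (mA a) (mB b))
  (tAB a) (AB a) g0 (gc a).
rewrite AT ge0_integral_bigcup//; last first.
  apply/measurable_EFinP; apply/measurable_fun_bigcup => // a.
  exact: (gA a).1.
transitivity (\sum_(a <oo) (expR (eta * a%:R) * pois (l1 * u) a)%:E *
    (expR (l2 * u * (expR (- eta) - 1)))%:E)%E.
  apply: eq_eseriesr => a _; rewrite (gA a).2 -nneseries_exp_tilt; last first.
    by rewrite mulr_ge0// ltW.
  rewrite -nneseriesZl/= => [|b _]; last first.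
    by rewrite lee_fin mulr_ge0 ?expR_ge0// pois_ge0// mulr_ge0// ltW.
  apply: eq_eseriesr => b _.
  rewrite [X in (_ * X)%E](N12 _ _ u0) (poisson_law l1_gt0 hN1)//.
  rewrite (poisson_law l2_gt0 hN2)// -!EFinM; congr EFin.
  by rewrite mulrBr -mulNr expRD; ring.
under eq_eseriesr do rewrite muleC.
rewrite nneseriesZl/= => [|a _]; last first.
  by rewrite lee_fin mulr_ge0 ?expR_ge0// pois_ge0// mulr_ge0// ltW.
rewrite nneseries_exp_tilt ?mulr_ge0 ?(ltW l1_gt0)// -EFinM -expRD.
by congr (expR _)%:E; rewrite /skellam_laplace_exponent opprK; ring.
Qed.

End Skellam.

Lemma nneseries_pois_bessel (R : realType) (l1 l2 u : R) (k : nat) :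
    0 < l1 -> 0 < l2 -> 0 <= u ->
  (\sum_(b <oo) (pois (l1 * u) (b + k) * pois (l2 * u) b)%:E)%E =
  ((l1 / l2) `^ (k%:R / 2) * (expR (- (u * (l1 + l2))) *
    besselI k (2 * u * Num.sqrt (l1 * l2))))%:E.
Proof.
move=> l10 l20 u0.
rewrite mulrA EFinM -nneseries_besselI ?mulr_ge0 ?sqrtr_ge0//.
have l120 : 0 <= l1 / l2 by rewrite divr_ge0 ?ltW.
rewrite (mulrC k%:R) powRrM powR12_sqrt// powR_mulrn ?sqrtr_ge0//.
set q := Num.sqrt (l1 * l2).
have q2 : q ^+ 2 = l1 * l2 by rewrite sqr_sqrtr// mulr_ge0 ?ltW.
(* Origin of the power [k / 2]: each of the [k] surplus factors [l1] splits into [q], absorbed by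
   the Bessel series, and [Num.sqrt (l1 / l2)]. *)
have sq : q * Num.sqrt (l1 / l2) = l1.
  rewrite -sqrtrM ?mulr_ge0 ?ltW// (_ : l1 * l2 * (l1 / l2) = l1 ^+ 2).
    by rewrite sqrtr_sqr ger0_norm ?ltW.
  by field; rewrite gt_eqF.
have uq0 : 0 <= u * q by rewrite mulr_ge0 ?sqrtr_ge0.
have -> : 2 * u * q / 2 = u * q by field.
rewrite -nneseriesZl/= => [|b _]; last by rewrite lee_fin divr_ge0// exprn_ge0.
apply: eq_eseriesr => b _; rewrite -EFinM; congr EFin.
have -> : (u * q) ^+ (2 * b + k) =
    (u ^+ 2 * (l1 * l2)) ^+ b * (u ^+ k * q ^+ k).
  by rewrite exprD exprM -q2 -!exprMn.
have -> : pois (l1 * u) (b + k) = (l1 ^+ b * (q ^+ k * Num.sqrt (l1 / l2) ^+ k)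
  *
    u ^+ (b + k)) / (b + k)`!%:R * expR (- (l1 * u)).
  by rewrite /pois -exprMn sq exprMn exprD.
have -> : - (u * (l1 + l2)) = - (l1 * u) + - (l2 * u) by ring.
rewrite expRD /pois !exprMn !exprD; field.
by rewrite !natr_fact_neq0.
Qed.


Section SkellamLaw.
Context (d : measure_display) (T : measurableType d) (R : realType).
Variables (P : probability T R) (l1 l2 : R) (N1 N2 : R -> T -> nat).
Hypothesis l1_gt0 : 0 < l1.
Hypothesis l2_gt0 : 0 < l2.
Hypothesis hN1 : poisson_process P l1 N1.
Hypothesis hN2 : poisson_process P l2 N2.
Hypothesis N12 : forall u (A B : set nat), 0 <= u ->
  P (N1 u @^-1` A `&` N2 u @^-1` B) = (P (N1 u @^-1` A) * P (N2 u @^-1` B))%E.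

Lemma skellam_law u (k : int) : 0 <= u ->
  P (skellam N1 N2 u @^-1` [set k]) =
  ((l1 / l2) `^ (k%:~R / 2) * (expR (- (u * (l1 + l2))) *
    besselI `|k|%N (2 * u * Num.sqrt (l1 * l2))))%:E.
Proof.
move=> u0; case: k => n.
  by rewrite (prob_skellam_ge0 l1_gt0 l2_gt0 hN1 hN2 N12)//
    nneseries_pois_bessel.
(* A negative value becomes positive when the two processes are exchanged; the inverted ratio of
   intensities accounts for the sign of the exponent. *)
rewrite (_ : _ @^-1` _ = skellam N2 N1 u @^-1` [set n.+1%:Z]); last first.
  by apply/seteqP; split=> w; rewrite /skellam /=; lia.
have N21 v (A B : set nat) : 0 <= v ->
    P (N2 v @^-1` A `&` N1 v @^-1` B) = (P (N2 v @^-1` A) * P (N1 v @^-1` B))%E.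
  by move=> v0; rewrite setIC muleC N12.
rewrite (prob_skellam_ge0 l2_gt0 l1_gt0 hN2 hN1 N21)// nneseries_pois_bessel//.
rewrite (addrC l2 l1) (mulrC l2 l1); congr (_ * _)%:E.
rewrite -[l2 / l1]invf_div -[(_ / _)^-1]powR_inv1 ?divr_ge0 ?ltW// -powRrM.
by congr powR; rewrite NegzE mulrNz; ring.
Qed.

End SkellamLaw.

(** * The Skellam process at the inverse time *)

Section TimeChange.
Context (d : measure_display) (T : measurableType d) (R : realType).
Variables (P : probability T R) (lambda l1 l2 beta : R).
Variables (N N1 N2 : R -> T -> nat) (xi : nat -> T -> R).
Hypothesis lambda_gt0 : 0 < lambda.
Hypothesis l1_gt0 : 0 < l1.
Hypothesis l2_gt0 : 0 < l2.
Hypothesis beta_gt0 : 0 < beta.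
Hypothesis hE : compound_poisson_exponential P lambda beta N xi.
Hypothesis hN1 : poisson_process P l1 N1.
Hypothesis hN2 : poisson_process P l2 N2.

Let Y := inverse_process (compound_sum N xi).
Let S := skellam N1 N2.
Let S_I := time_changed S Y.

Hypothesis hind :
  independent3 P (process_sigma N1) (process_sigma N2) (process_sigma Y).

Lemma independent_poisson u (A B : set nat) : 0 <= u ->
  P (N1 u @^-1` A `&` N2 u @^-1` B) = (P (N1 u @^-1` A) * P (N2 u @^-1` B))%E.
Proof.
move=> u0; have YT : process_sigma Y (Y 0 @^-1` setT).
  exact: process_sigma_preimage.
have NA : process_sigma N1 (N1 u @^-1` A) by exact: process_sigma_preimage.
have NB : process_sigma N2 (N2 u @^-1` B) by exact: process_sigma_preimage.
by have [] := independent3E hind NA NB YT.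
Qed.

Let S_cst (K : set int) w y : 0 < y -> exists2 e : R, 0 < e &
  forall v : R, 0 <= v -> (y <= v < y + e) ->
  (S v @^-1` K) w <-> (S y @^-1` K) w.
Proof.
move=> y0; have [e e0 Se] := skellam_right_cst hN1 hN2 w (ltW y0).
by exists e => // v v0 yv; rewrite /preimage /= /S Se.
Qed.

Let mS (K : set int) u : 0 <= u -> measurable (S u @^-1` K).
Proof. by move=> u0; exact: (measurable_skellam hN1 hN2). Qed.

Lemma measurable_prob_skellam (K : set int) :
  measurable_fun (`]0, +oo[ : set R) (fun u => P (S u @^-1` K)).
Proof.
exact: (@measurable_randomized_probability _ _ _ P (fun u => S u @^-1` K) true
  (@mS K) (@S_cst K)).
Qed.

Lemma prob_time_changed (K : set int) t : 0 <= t ->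
  measurable (S_I t @^-1` K) /\
  P (S_I t @^-1` K) = (\int[lebesgue_measure]_(u in `]0%R, +oo[)
    (P (S u @^-1` K) * (inverse_density lambda beta t u)%:E))%E.
Proof.
move=> t0; have mY := measurable_inverse_process hE t.
have mYB B : measurable B -> measurable (Y t @^-1` B).
  by move=> mB; rewrite -[X in measurable X]setTI; exact: mY.
have [|||u u0|u a b u0 a0 ab|w y y0|mZ PZ] := @probability_randomization _ _ _ P
    (Y t) (inverse_density lambda beta t) (fun u => S u @^-1` K) true mY.
- apply: measurable_inverse_density => //; try exact: ltW.
  by move=> v; rewrite /= !in_itv/= !andbT => /ltW.
- by move=> u u0; apply: inverse_density_ge0 => //; exact: ltW.
- by move=> a b a0 ab; exact: (prob_inverse_process_itv lambda_gt0 beta_gt0 hE).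
- exact: mS.
- apply: (prob_skellam_indep hN1 hN2 independent_poisson) => //.
    by apply: mYB; exact: measurable_itv.
  move=> A B; have YC : process_sigma Y (Y t @^-1` `]a, b]).
    by apply: process_sigma_preimage => //; exact: measurable_itv.
  have NA : process_sigma N1 (N1 u @^-1` A) by exact: process_sigma_preimage.
  have NB : process_sigma N2 (N2 u @^-1` B) by exact: process_sigma_preimage.
  by have [] := independent3E hind NA NB YC.
- exact: S_cst.
(* The null part where [Y t] vanishes is kept explicit, since measurability of the whole event is
   also claimed. *)
have SE : S_I t @^-1` K = [set w | 0 < Y t w /\ (S (Y t w) @^-1` K) w] `|`
    (Y t @^-1` `]-oo, 0] `&` S 0 @^-1` K).
  apply/seteqP; split=> [w Kw|w [[_]//|[+ Kw]]].
    have [Y0|Y0] := ltP 0 (Y t w); first by left.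
    have Y_eq0 : Y t w = 0.
      by apply/eqP; rewrite eq_le Y0; exact: (inverse_process_ge0 N xi t w).
    right; split; first by rewrite /= in_itv.
    by rewrite /preimage/= -Y_eq0.
  rewrite /= in_itv/= => Y0.
  have Y_eq0 : Y t w = 0.
    by apply/eqP; rewrite eq_le Y0; exact: (inverse_process_ge0 N xi t w).
  by rewrite /preimage /S_I /time_changed /= Y_eq0.
have mSI : measurable (S_I t @^-1` K).
  rewrite SE; apply: measurableU => //; apply: measurableI; last exact: mS.
  by apply: mYB; exact: measurable_itv.
split => //; rewrite -PZ.
apply: (eq_probability mSI mZ _
  (prob_inverse_process_le0 lambda_gt0 beta_gt0 hE t0)).
  by apply: mYB; exact: measurable_itv.
move=> w; rewrite /= in_itv/= => /negP; rewrite -ltNge => Y0.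
by split=> [|[]].
Qed.

End TimeChange.

(* The nonempty [pickle_atom n] are the singletons of the countable type [C]. *)
Definition pickle_atom (C : countType) (n : nat) : set C :=
  [set k | pickle k = n].

(** The series runs over codes; a number that codes no element contributes the default value 0 on an
    empty event. *)
Lemma integral_countType (d : measure_display) (T : measurableType d)
    (R : realType) (P : probability T R) (C : countType) (X : T -> C)
    (g : C -> R) :
    (forall n, measurable (X @^-1` @pickle_atom C n)) -> (forall k, 0 <= g k) ->
  (\int[P]_w (g (X w))%:E =
   \sum_(n <oo) (oapp g 0 (@pickle_inv C n))%:E * P (X @^-1` @pickle_atom C
     n))%E.
Proof.
move=> mX g0.
have XT : setT = \bigcup_n X @^-1` @pickle_atom C n.
  by apply/seteqP; split=> // w _; exists (pickle (X w)).
have tX : trivIset setT (fun n => X @^-1` @pickle_atom C n).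
  by move=> i j _ _ [w [/= <- <-]].
apply: (integral_countable_partition _ mX tX XT _ _).2 => // n w <-.
by rewrite pickleK_inv.
Qed.

Theorem theorem7 (d : measure_display) (T : measurableType d) (R : realType)
    (P : probability T R) (lambda lambda1 lambda2 beta : R)
    (N N1 N2 : R -> T -> nat) (xi : nat -> T -> R)
    (lambda_gt0 : 0 < lambda) (lambda1_gt0 : 0 < lambda1)
    (lambda2_gt0 : 0 < lambda2) (beta_gt0 : 0 < beta)
    (hE : compound_poisson_exponential P lambda beta N xi)
    (hN1 : poisson_process P lambda1 N1)
    (hN2 : poisson_process P lambda2 N2) :
  let Y := inverse_process (compound_sum N xi) in
  let S := skellam N1 N2 in
  let S_I := time_changed S Y in
  let f_s := skellam_laplace_exponent lambda1 lambda2 in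
  independent3 P (process_sigma N1) (process_sigma N2) (process_sigma Y) ->
  [/\ forall (t : R) (k : int), 0 <= t ->
        P [set w | S_I t w = k] =
        ((lambda * expR (- (beta * t))
            * (lambda1 / lambda2) `^ (k%:~R / 2))%:E
         * \int[lebesgue_measure]_(u in `[0%R, +oo[)
             (expR (- (u * (lambda1 + lambda2 + lambda)))
              * besselI `|k|%N (2 * u * Num.sqrt (lambda1 * lambda2))
              * besselI 0%N (2 * Num.sqrt (lambda * beta * u * t)))%:E)%E,
      (* the formula holds wherever the moment generating function is finite,
         and it is finite as soon as lambda + f_s (- theta) > 0 *)
      forall t theta : R, 0 <= t -> lambda + f_s (- theta) != 0 ->
        let M := mmt_gen_fun P (fun w => (S_I t w)%:~R) theta in
        ((M < +oo)%E ->
          M = (lambda / (lambda + f_s (- theta))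
               * expR (- (beta * t)
                       * (f_s (- theta) / (lambda + f_s (- theta)))))%:E)
        /\ (0 < lambda + f_s (- theta) -> (M < +oo)%E)
    & forall t theta : R, 0 <= t ->
        mmt_gen_fun P (fun w => (S t w)%:~R) (- theta)
        = (expR (- (t * f_s theta)))%:E ].
Proof.
move=> Y S S_I f_s hind.
have N12 := independent_poisson hind.
have PSI K t (t0 : 0 <= t) := prob_time_changed lambda_gt0 beta_gt0 hE
  hN1 hN2 hind K t0.
have mPS K := measurable_prob_skellam hN1 hN2 K.
have mmtE (X : T -> int) eta : mmt_gen_fun P (fun w => (X w)%:~R) eta =
    (\int[P]_w (expR (eta * (X w)%:~R))%:E)%E.
  rewrite /mmt_gen_fun unlock; apply: eq_integral => w _ /=.
  by rewrite mulrC.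
have mgfS u eta : 0 <= u -> (\int[P]_w (expR (eta * (S u w)%:~R))%:E)%E =
    (expR (- (u * f_s (- eta))))%:E.
  exact: skellam_mgf lambda1_gt0 lambda2_gt0 hN1 hN2 N12 u eta.
have mf t (D : set R) : 0 <= t -> measurable D -> D `<=` `[0, +oo[ ->
    measurable_fun D (inverse_density lambda beta t).
  exact: measurable_inverse_density (ltW lambda_gt0) (ltW beta_gt0).
have sub0 : (`]0, +oo[ : set R) `<=` `[0, +oo[.
  by move=> v; rewrite /= !in_itv/= !andbT => /ltW.
have f_ge0 t u : 0 <= t -> 0 <= u -> 0 <= inverse_density lambda beta t u.
  exact: inverse_density_ge0 (ltW lambda_gt0) (ltW beta_gt0).
split.
- move=> t k t0; rewrite [LHS](PSI [set k] t t0).2.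
  set C := lambda * _ * _.
  have C0 : 0 < C.
    by rewrite /C mulr_gt0 ?powR_gt0 ?divr_gt0// mulr_gt0 ?expR_gt0.
  pose h u := (P (S u @^-1` [set k]) * (inverse_density lambda beta t u)%:E)%E.
  have mh : measurable_fun (`]0, +oo[ : set R) h.
    by apply: emeasurable_funM; [exact: mPS|apply/measurable_EFinP; exact: mf].
  have h_ge0 u : 0 < u -> (0 <= h u)%E.
    by move=> u0; rewrite mule_ge0 ?measure_ge0// lee_fin f_ge0// ltW.
  pose g u := (expR (- (u * (lambda1 + lambda2 + lambda)))
              * besselI `|k|%N (2 * u * Num.sqrt (lambda1 * lambda2))
              * besselI 0%N (2 * Num.sqrt (lambda * beta * u * t))).
  have gh u : 0 < u -> (g u)%:E = ((C^-1)%:E * h u)%E.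
    move=> /ltW u0; rewrite /h (skellam_law lambda1_gt0 lambda2_gt0 hN1 hN2
      N12)//.
    rewrite -!EFinM; congr EFin; rewrite /inverse_density /g /C.
    rewrite (_ : - (u * (lambda1 + lambda2 + lambda)) =
      - (u * (lambda1 + lambda2)) + - (u * lambda)); last by ring.
    rewrite expRD; field.
    by rewrite !gt_eqF ?expR_gt0// powR_gt0// divr_gt0.
  (* Measurability of the Bessel integrand is inherited from [h], that is, from the probabilities of
     [S u = k] as functions of [u]. *)
  rewrite -integral_itv_obnd_cbnd; last first.
    apply: (eq_measurable_fun (fun u => (C^-1)%:E * h u)%E).
      by move=> u; rewrite inE/= in_itv/= andbT => /gh.
    exact: measurable_funeM.
  under [in RHS]eq_integral => u.
    rewrite inE/= in_itv/= andbT => u0; rewrite (gh u u0); over.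
  rewrite ge0_integralZl//.
  + by rewrite muleA -EFinM mulfV ?gt_eqF// mul1e.
  + by move=> u; rewrite /= in_itv/= andbT => /h_ge0.
  + by rewrite lee_fin invr_ge0 ltW.
- move=> t theta t0; set a := f_s (- theta) => c_neq0 /=.
  set M := mmt_gen_fun _ _ _.
  (* At each fixed [u] the exponential moment of [S u] is [expR (- a * u)]. The sum over the values
     of [S] and the integral over [u] are exchanged by nonnegativity, so the identity also covers an
     infinite [M]. *)
  have ME : M = (\int[lebesgue_measure]_(u in `[0%R, +oo[)
     (expR (- a * u) * inverse_density lambda beta t u)%:E)%E.
    have gt_ge0 (k : int) : 0 <= expR (theta * k%:~R) :> R by exact: expR_ge0.
    rewrite /M mmtE (integral_countType P (X := S_I t)
      (g := fun k => expR (theta * k%:~R)))//; last first.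
      by move=> n; exact: (PSI _ t t0).1.
    rewrite -integral_itv_obnd_cbnd; last first.
      apply/measurable_EFinP; apply: measurable_funM; last exact: mf.
      exact: measurable_exp_mull.
    have c_ge0 n : (0 <= (oapp (fun k : int => expR (theta * k%:~R) : R) 0
        (@pickle_inv int n))%:E)%E.
      by case: pickle_inv => //= k; rewrite lee_fin expR_ge0.
    transitivity (\int[lebesgue_measure]_(u in `]0%R, +oo[)
        \sum_(n <oo) ((oapp (fun k : int => expR (theta * k%:~R) : R) 0
        (@pickle_inv int n))%:E * (P (S u @^-1` @pickle_atom int n) *
          (inverse_density lambda beta t u)%:E)))%E.
      rewrite integral_nneseries//; last 2 first.
      - move=> n; apply: measurable_funeM; apply: emeasurable_funM;
          [exact: mPS|by apply/measurable_EFinP; exact: mf].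
      - move=> n u; rewrite /= in_itv/= andbT => /ltW u0.
        by rewrite !mule_ge0 ?measure_ge0// lee_fin f_ge0.
      apply: eq_eseriesr => n _; rewrite (PSI _ t t0).2 ge0_integralZl//.
      - apply: emeasurable_funM;
          [exact: mPS|by apply/measurable_EFinP; exact: mf].
      - move=> u; rewrite /= in_itv/= andbT => /ltW u0.
        by rewrite !mule_ge0 ?measure_ge0// lee_fin f_ge0.
    apply: eq_integral => u; rewrite inE/= in_itv/= andbT => /ltW u0.
    rewrite (_ : - a * u = - (u * a)); last by ring.
    rewrite [RHS]EFinM; have := mgfS u theta u0; rewrite -/a => <-.
    rewrite (integral_countType P (X := S u)
      (g := fun k => expR (theta * k%:~R)))//; last first.
      by move=> n; exact: (measurable_skellam hN1 hN2).
    rewrite muleC -nneseriesZl => [|n _]; last by rewrite mule_ge0.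
    by apply: eq_eseriesr => n _; rewrite [RHS]muleC muleA.
  (* A positive value gives the formula, a negative one an infinite integral, against [M < +oo], and
     zero is excluded by hypothesis. *)
  rewrite ME; case: (ltgtP 0 (lambda + a)) => [c0|c0|/eqP]; last first.
  + by rewrite eq_sym (negbTE c_neq0).
  + by rewrite (integral_exp_inverse_density_pinfty _ (ltW beta_gt0) t0)//.
  + rewrite (integral_exp_inverse_density _ (ltW beta_gt0) t0)//.
    by split => // _; rewrite ltry.
- by move=> t theta t0; rewrite mmtE mgfS// opprK.
Qed.
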